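(* Let $r \ge 3$ and $p = p(n)$. The following bounds hold with high probability as $n\to\infty$: (i) if $n^{-2} \ll p \ll n^{-2/(r+1)}$, then $\log_2 S_r(n,p) = \big(1+o(1)\big)\, p\binom{n}{2}$; (ii) if $p \gg n^{-2/(r+1)}$, then $\log_2 S_r(n,p) = \widetilde{\Theta}\Big(\dfrac{n}{p^{(r-1)/2}}\Big)$.
   Context: $G(n,p)$ is the Erdős–Rényi random graph on $n$ vertices with edge probability $p$. An orientation of a graph assigns a direction to each edge. $S_r(n,p)$ is the random variable counting the number of orientations of $G(n,p)$ in which no copy of $K_r$ is strongly connected. $f \ll g$ (equivalently $g\gg f$) means $f/g\to0$ as $n\to\infty$. $X=\widetilde{\Theta}(g)$ means $X$ is bounded above and below by $g$ up to polylogarithmic factors in $n$. *)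

(* Defs.v *)
From HB Require Import structures.
From mathcomp Require Import all_boot all_order all_algebra.
From mathcomp Require Import all_classical all_reals all_analysis.

Set Implicit Arguments.
Unset Strict Implicit.
Unset Printing Implicit Defensive.

Import Order.TTheory GRing.Theory Num.Theory.
Import numFieldNormedType.Exports.

Local Open Scope classical_set_scope.
Local Open Scope ring_scope.

(* A graph on the vertex set 'I_n is given by its set of edges, a subset of
   [pairs n]; a digraph by its set of arcs, (u, v) being the arc u -> v. *)
Definition pairs (n : nat) : {set {set 'I_n}} := [set e : {set 'I_n} | #|e| == 2]%SET.

(* Loops are excluded as soon as G \subset pairs n, since #|[set u; u]| = 1. *)
Definition adj (n : nat) (G : {set {set 'I_n}}) (u v : 'I_n) : bool :=
  ([set u; v] \in G)%SET.

Definition orientation (n : nat) (G : {set {set 'I_n}})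
    (D : {set 'I_n * 'I_n}) : bool :=
  [forall u, forall v,
    if adj G u v then ((u, v) \in D) (+) ((v, u) \in D) else (u, v) \notin D].

(* The copies of K_r in G are identified with their vertex sets. *)
Definition clique_copy (r n : nat) (G : {set {set 'I_n}}) (K : {set 'I_n}) : bool :=
  (#|K| == r) && [forall u in K, forall v in K, (u != v) ==> adj G u v].

(* Directed paths must stay inside K. *)
Definition strongly_connected (n : nat) (D : {set 'I_n * 'I_n})
    (K : {set 'I_n}) : bool :=
  [forall u in K, forall v in K,
    connect [rel x y | [&& x \in K, y \in K & (x, y) \in D]] u v].

Definition Sr (r n : nat) (G : {set {set 'I_n}}) : nat :=
  #|[set D : {set 'I_n * 'I_n} | orientation G D &
      [forall K, clique_copy r G K ==> ~~ strongly_connected D K]]%SET|.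

Definition log2 (R : realType) (x : R) : R := ln x / ln 2.

Definition gnp_mass (R : realType) (n : nat) (p : R) (G : {set {set 'I_n}}) : R :=
  \prod_(e in pairs n) (if e \in G then p else 1 - p).

Definition gnp_prob (R : realType) (n : nat) (p : R)
    (A : pred {set {set 'I_n}}) : R :=
  \sum_(G in powerset (pairs n) | A G) gnp_mass p G.

Lemma gnp_prob_total (R : realType) (n : nat) (p : R) :
  gnp_prob p (fun _ : {set {set 'I_n}} => true) = 1.
Proof.
rewrite /gnp_prob.
have := @bigA_distr R 0 1 *%R +%R _
  (fun e : {set 'I_n} => if e \in pairs n then p else 0)
  (fun e : {set 'I_n} => if e \in pairs n then 1 - p else 1).
rewrite big1 => [->|e _]; last by case: ifP => _ /=; rewrite ?add0r // subrKC.
rewrite big_mkcond [RHS]big_mkcond /=; apply: eq_bigr => G _.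
rewrite powersetE andbT; case: ifPn => [sG|/subsetPn[e eG eN]]; last first.
  by rewrite (bigD1 e) //= eG (negPf eN) mul0r.
rewrite /gnp_mass big_mkcond /=; apply: eq_bigr => e _.
by have [//|eN] := boolP (e \in pairs n); rewrite (contraNF (fintype.subsetP sG e) eN).
Qed.

Definition whp (R : realType) (p : nat -> R)
    (A : forall n, pred {set {set 'I_n}}) : Prop :=
  gnp_prob (p n) (@A n) @[n --> \oo] --> (1 : R).

(* f << g. As x / 0 = 0 here, g must be required to be eventually nonzero. *)
Definition much_less (R : realType) (f g : nat -> R) : Prop :=
  (\forall n \near \oo, g n != 0) /\ (f n / g n @[n --> \oo] --> (0 : R)).

(* With high probability, X = (1 + o(1)) a. *)
Definition whp_asymp (R : realType) (p : nat -> R)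
    (X : forall n, {set {set 'I_n}} -> R) (a : nat -> R) : Prop :=
  exists delta : nat -> R, (delta n @[n --> \oo] --> (0 : R)) /\
    whp p (fun n G => (1 - delta n) * a n <= X n G <= (1 + delta n) * a n).

(* With high probability, X = \widetilde{\Theta}(g). *)
Definition whp_tildeTheta (R : realType) (p : nat -> R)
    (X : forall n, {set {set 'I_n}} -> R) (g : nat -> R) : Prop :=
  exists (C : R) (k : nat), 0 < C /\
    whp p (fun n G => g n / (C * ln n%:R ^+ k) <= X n G <= C * ln n%:R ^+ k * g n).

(* Main.v *)
(* Upper bound in (ii).  Orient the edges vertex by vertex.  For a K_{r-1} inside
   the earlier neighbours of v, let x reach all of it and all of it reach y; no
   strongly connected K_r means that v -> x forces v -> y.  So the set of earlier
   out-neighbours of v is closed under these forcings, hence is determined by a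
   minimal generating set, which contains no K_{r-1}.  If every s-set of vertices
   of G contains a K_{r-1}, this leaves at most (n+1)^s choices for each v.
   Janson's inequality, for a randomly thinned family of cliques, shows that
   whp this holds with s of order (ln n) / p^((r-1)/2).

   Lower bounds.  Cut the vertices into blocks and orient every edge increasingly,
   reversing at will the edges inside a block that lie in no K_r of their block.
   With blocks of size s, about p^(-(r+1)/2) / ln n, most of the p n s / 2 edges
   inside blocks are free; in (i) a single block suffices.

   Throughout, w is the square root of p, so that all exponents are natural
   numbers. *)
Require Import Defs.
From HB Require Import structures.
From mathcomp Require Import all_boot all_order all_algebra.
From mathcomp Require Import all_classical all_reals all_analysis.
From mathcomp Require Import ring lra zify finset.

Set Implicit Arguments.
Unset Strict Implicit.
Unset Printing Implicit Defensive.

Import Order.TTheory GRing.Theory Num.Theory.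
Import numFieldNormedType.Exports.

Local Open Scope ring_scope.

(** * Random subsets *)

Section ProductMeasure.
Variables (R : realType) (T : finType) (E : {set T}) (p : R).
Hypothesis p01 : 0 <= p <= 1.
Implicit Types (f g : {set T} -> R) (F G : {set T}) (e : T).

(** A finite sum over the subsets of [E], so no measure theory enters; [gnp_probE] identifies the
    case [E = pairs n] with the random graph. *)
Definition expect f : R :=
  \sum_(G in powerset E) (\prod_(e in E) (if e \in G then p else 1 - p)) * f G.

Lemma mass_ge0 G : 0 <= \prod_(e in E) (if e \in G then p else 1 - p).
Proof.
by case/andP: p01 => p0 p1; apply: prodr_ge0 => e _; case: ifP; rewrite ?subr_ge0.
Qed.

Lemma ler_expect f g : (forall G, G \subset E -> f G <= g G) ->
  expect f <= expect g.
Proof.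
move=> fg; apply: ler_sum => G; rewrite powersetE => GE.
by apply: ler_wpM2l; [exact: mass_ge0 | exact: fg].
Qed.

Lemma eq_expect f g : (forall G, G \subset E -> f G = g G) ->
  expect f = expect g.
Proof.
by move=> fg; apply: eq_bigr => G; rewrite powersetE => GE; rewrite fg.
Qed.

Lemma expect_ge0 f : (forall G, G \subset E -> 0 <= f G) -> 0 <= expect f.
Proof.
move=> f0; apply: sumr_ge0 => G; rewrite powersetE => GE.
by apply: mulr_ge0; [exact: mass_ge0 | exact: f0].
Qed.

Lemma expectZ c f : expect (fun G => c * f G) = c * expect f.
Proof. by rewrite mulr_sumr; apply: eq_bigr => G _; rewrite mulrCA. Qed.

Lemma expectD f g : expect (fun G => f G + g G) = expect f + expect g.
Proof. by rewrite -big_split; apply: eq_bigr => G _; rewrite mulrDr. Qed.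

Lemma expect_sum (I : finType) (P : pred I) (f : I -> {set T} -> R) :
  expect (fun G => \sum_(i | P i) f i G) = \sum_(i | P i) expect (f i).
Proof.
by rewrite exchange_big; apply: eq_bigr => G _; rewrite mulr_sumr.
Qed.

(** Pair each [G] avoiding [e] with [e |: G]: the other elements contribute the same factor [m G] to
    both masses, and summing out the state of [e] leaves [p * f (e |: G)] weighted by [m G] on
    either side. *)
Lemma expect_mem1 e f : e \in E ->
  expect (fun G => (e \in G)%:R * f G) = p * expect (fun G => f (e |: G)).
Proof.
move=> eE; pose m G := \prod_(x in E | x != e) (if x \in G then p else 1 - p).
have mU G : m (e |: G) = m G.
  by apply: eq_bigr => x /andP[_ /negPf xe]; rewrite in_setU1 xe.
have massE G : \prod_(x in E) (if x \in G then p else 1 - p) =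
    (if e \in G then p else 1 - p) * m G by rewrite (bigD1 e).
have split_sum f' : expect f' =
    \sum_(G in powerset E | e \notin G) m G * (p * f' (e |: G) + (1 - p) * f' G).
  rewrite /expect (bigID (fun G => e \in G)) /=.
  rewrite (reindex_onto (fun G => e |: G) (fun G => G :\ e)) /=; last first.
    by move=> G /andP[_ eG]; rewrite finset.setD1K.
  under eq_bigl => G.
    rewrite setU11 !powersetE andbT subUset sub1set eE /=.
    have -> : (((e |: G) :\ e)%SET == G) = (e \notin G).
      apply/eqP/idP => [<-|]; first by rewrite setD11.
      exact: finset.setU1K.
    over.
  under [X in _ + X]eq_bigl => G do rewrite powersetE.
  rewrite -big_split; under [RHS]eq_bigl => G do rewrite powersetE.
  apply: eq_bigr => G /andP[_ /negPf eG].
  by rewrite !massE mU eG setU11 /=; ring.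
rewrite !split_sum mulr_sumr; apply: eq_bigr => G /andP[_ /negPf eG].
by rewrite setU11 eG finset.setUA finset.setUid /=; ring.
Qed.

(** By independence, conditioning on [F \subset G] amounts to replacing [G] by [F :|: G]. Subset
    probabilities, the Harris bound and the independence used for Janson all come from this
    identity. *)
Lemma expect_mem F f : F \subset E ->
  expect (fun G => (F \subset G)%:R * f G) = p ^+ #|F| * expect (fun G => f (F :|: G)).
Proof.
have [n] := ubnP #|F|; elim: n F f => // n IH F f ltF FE.
have [->|[e eF]] := set_0Vmem F.
  rewrite cards0 expr0 mul1r; apply: eq_expect => G GE.
  by rewrite sub0set mul1r set0U.
have eE := fintype.subsetP FE e eF.
rewrite (_ : expect _ =
    expect (fun G => (e \in G)%:R * ((F :\ e \subset G)%:R * f G))); last first.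
  apply: eq_expect => G _; rewrite -{1}(finset.setD1K eF) subUset sub1set.
  by rewrite -mulnb natrM mulrA.
rewrite expect_mem1 // (cardsD1 e F) eF exprS -mulrA; congr (_ * _).
rewrite (_ : expect _ = expect (fun G => (F :\ e \subset G)%:R * f (e |: G))); last first.
  by apply: eq_expect => G _; rewrite subDset finset.setUA finset.setUid -subDset.
rewrite (IH _ (fun G => f (e |: G))).
- by congr (_ * _); apply: eq_expect => G _; rewrite finset.setUA finset.setD1K.
- by rewrite (cardsD1 e F) eF in ltF.
- by apply: fintype.subset_trans FE; rewrite subD1set.
Qed.

(** Expand a product over all of [T] whose factors are [p + (1 - p)] on [E] and [0 + 1] elsewhere:
    only subsets of [E] survive. *)
Lemma expect1 : expect (fun=> 1) = 1.
Proof.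
have := @bigA_distr R 0 1 *%R +%R _
  (fun e : T => if e \in E then p else 0) (fun e : T => if e \in E then 1 - p else 1).
rewrite big1 => [sum1|e _]; last by case: ifP => _ /=; rewrite ?add0r // subrKC.
transitivity (\sum_(G in powerset E) \prod_(e in E) (if e \in G then p else 1 - p)).
  by apply: eq_bigr => G _; rewrite mulr1.
apply: etrans (esym sum1).
rewrite big_mkcond [RHS]big_mkcond /=; apply: eq_bigr => G _.
rewrite powersetE; case: ifPn => [sG|/subsetPn[e eG eN]]; last first.
  by rewrite (bigD1 e) //= eG (negPf eN) mul0r.
rewrite big_mkcond /=; apply: eq_bigr => e _.
by have [//|eN] := boolP (e \in E); rewrite (contraNF (fintype.subsetP sG e) eN).
Qed.

Definition prob (A : pred {set T}) : R := expect (fun G => (A G)%:R).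

Lemma prob_subset F : F \subset E -> prob (fun G => F \subset G) = p ^+ #|F|.
Proof.
move=> FE; rewrite -[RHS]mulr1 -expect1 -(expect_mem (fun=> 1) FE).
by apply: eq_expect => G _; rewrite mulr1.
Qed.

Lemma le_prob (A B : pred {set T}) : (forall G, G \subset E -> A G -> B G) -> prob A <= prob B.
Proof.
move=> AB; apply: ler_expect => G GE; rewrite ler_nat.
by case: (boolP (A G)) => // /(AB _ GE) ->.
Qed.

Lemma probC (A : pred {set T}) : prob A = 1 - prob (fun G => ~~ A G).
Proof.
apply/esym/(canLR (addrK _)); rewrite /prob -expectD.
apply: etrans (esym expect1) _; apply: eq_expect => G _.
by case: (A G); rewrite ?addr0 ?add0r.
Qed.

Lemma prob_ge0 (A : pred {set T}) : 0 <= prob A. Proof. exact: expect_ge0. Qed.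

Lemma prob_le1 (A : pred {set T}) : prob A <= 1.
Proof. by rewrite probC gerBl prob_ge0. Qed.

Lemma probU (A B : pred {set T}) : prob (fun G => A G || B G) <= prob A + prob B.
Proof.
rewrite /prob -expectD; apply: ler_expect => G _.
by case: (A G); case: (B G); rewrite ?addr0 ?add0r ?lerDl.
Qed.

Lemma prob_exists (I : finType) (P : pred I) (A : I -> pred {set T}) :
  prob (fun G => [exists i, P i && A i G]) <= \sum_(i | P i) prob (A i).
Proof.
rewrite /prob -expect_sum; apply: ler_expect => G _.
case: existsP => [[i /andP[Pi Ai]]|_]; last by rewrite sumr_ge0.
by rewrite (bigD1 i) //= Ai lerDl sumr_ge0.
Qed.

Lemma markov_ineq f c : 0 < c -> (forall G, G \subset E -> 0 <= f G) ->
  prob (fun G => c <= f G) <= expect f / c.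
Proof.
move=> c0 f0; rewrite ler_pdivlMr // mulrC -expectZ; apply: ler_expect => G GE.
by case: (leP c (f G)) => [|_] /=; rewrite ?mulr1 ?mulr0 ?f0.
Qed.

Lemma expect_card_sub (D : {set T}) : D \subset E ->
  expect (fun G => #|G :&: D|%:R) = p * #|D|%:R.
Proof.
move=> DE; rewrite (_ : expect _ =
   expect (fun G => \sum_(e in D) ([set e] \subset G)%:R)); last first.
  apply: eq_expect => G _; rewrite -sum1_card natr_sum big_mkcond [RHS]big_mkcond /=.
  apply: eq_bigr => e _; rewrite inE sub1set andbC.
  by case: (e \in D) => //=; case: (e \in G).
rewrite expect_sum (eq_bigr (fun=> p)) ?sumr_const ?mulr_natr// => e eD.
transitivity (p ^+ #|[set e]|); last by rewrite cards1.
by apply: prob_subset; rewrite sub1set (fintype.subsetP DE).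
Qed.

Lemma variance_card_sub (D : {set T}) : D \subset E ->
  expect (fun G => (#|G :&: D|%:R - p * #|D|%:R) ^+ 2) <= p * #|D|%:R.
Proof.
move=> DE; set M := p * _.
have cardE G : #|G :&: D|%:R = \sum_(e in D) (e \in G)%:R :> R.
  rewrite -sum1_card natr_sum big_mkcond [RHS]big_mkcond /=.
  apply: eq_bigr => e _; rewrite inE andbC.
  by case: (e \in D) => //=; case: (e \in G).
have sq : expect (fun G => #|G :&: D|%:R ^+ 2) <= M + M ^+ 2.
  rewrite (_ : expect _ = \sum_(e in D) \sum_(e' in D)
      prob (fun G => [set e; e'] \subset G)); last first.
    rewrite (_ : expect _ = expect (fun G => \sum_(e in D) \sum_(e' in D)
      ([set e; e'] \subset G)%:R)); last first.
      apply: eq_expect => G _; rewrite cardE expr2 mulr_suml; apply: eq_bigr => e _.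
      rewrite mulr_sumr; apply: eq_bigr => e' _.
      by rewrite subUset !sub1set -mulnb natrM.
    by rewrite expect_sum; apply: eq_bigr => e _; rewrite expect_sum.
  (* Row [e] of the double sum has a diagonal term [p] and off-diagonal terms [p ^+ 2]; the extra
     [p ^+ 2] granted to the diagonal is slack. *)
  have -> : M + M ^+ 2 = \sum_(e in D) (p + p ^+ 2 * #|D|%:R).
    by rewrite sumr_const -mulr_natr /M; ring.
  apply: ler_sum => e eD.
  have -> : p ^+ 2 * #|D|%:R = \sum_(e' in D) p ^+ 2 by rewrite sumr_const mulr_natr.
  have p0 : 0 <= p by case/andP: p01.
  rewrite [X in _ <= _ + X](bigD1 e) //= (bigD1 e) //= addrA.
  have eE := fintype.subsetP DE e eD.
  apply: lerD.
    rewrite prob_subset ?finset.setUid ?sub1set// cards1 expr1 lerDl.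
    by rewrite exprn_ge0.
  apply: ler_sum => e' /andP[e'D ne].
  rewrite prob_subset ?cards2 1?eq_sym ?ne //.
  by rewrite subUset !sub1set eE (fintype.subsetP DE).
rewrite (_ : expect _ = expect (fun G => #|G :&: D|%:R ^+ 2) - M ^+ 2).
  by rewrite lerBlDr.
rewrite (_ : expect _ = expect (fun G => #|G :&: D|%:R ^+ 2 +
    ((- (2 * M)) * #|G :&: D|%:R + M ^+ 2 * 1))); last first.
  by apply: eq_expect => G _; ring.
rewrite expectD expectD !expectZ expect1 expect_card_sub // -/M; ring.
Qed.

Lemma chebyshev_card (D : {set T}) d : D \subset E -> 0 < d -> 0 < p * #|D|%:R ->
  prob (fun G => d * (p * #|D|%:R) <= `|#|G :&: D|%:R - p * #|D|%:R|) <=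
    (d ^+ 2 * (p * #|D|%:R))^-1.
Proof.
move=> DE d0 M0; set M := p * _.
have dM0 : 0 < (d * M) ^+ 2 by rewrite exprn_gt0 // mulr_gt0.
apply: (@le_trans _ _ (prob (fun G => (d * M) ^+ 2 <= (#|G :&: D|%:R - M) ^+ 2))).
  apply: le_prob => G _ H; rewrite -[leRHS]real_normK ?num_real //.
  by rewrite ler_pXn2r // ?nnegrE // ltW // mulr_gt0.
apply: (le_trans (markov_ineq dM0 _)) => [G _|]; first exact: sqr_ge0.
rewrite ler_pdivrMr //; apply: (le_trans (variance_card_sub DE)); rewrite -/M.
by rewrite [leRHS](_ : _ = M) //; field; rewrite !gt_eqF.
Qed.

End ProductMeasure.

(** * Janson's inequality *)

Section Janson.
Variables (R : realType) (T : finType) (E : {set T}) (p : R).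
Hypothesis p01 : 0 <= p <= 1.
Implicit Types (f : {set T} -> R) (F G : {set T}) (s : seq {set T}).

(* The special case of Harris' inequality in which the increasing event is
   generated by one set. *)
Lemma harris_subset F f : F \subset E ->
  (forall G, G \subset E -> f (F :|: G) <= f G) ->
  expect E p (fun G => (F \subset G)%:R * f G) <= p ^+ #|F| * expect E p f.
Proof.
move=> FE fdec; rewrite expect_mem //; apply: ler_wpM2l; last exact: ler_expect.
by rewrite exprn_ge0 //; case/andP: p01.
Qed.

(* On the event that no member of [s] is contained in G this weight is 1;
   lowering [q] below 1 corresponds to thinning the family [s] at random. *)
Definition avoid (q : R) s G : R := \prod_(F <- s) (1 - q * (F \subset G)%:R).

Lemma avoid_ge0 q s G : 0 <= q <= 1 -> 0 <= avoid q s G.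
Proof.
move=> /andP[q0 q1]; apply: prodr_ge0 => F _.
by case: (F \subset G); rewrite ?mulr1 ?mulr0 ?subr0 ?subr_ge0.
Qed.

Lemma avoid_le1 q s G : 0 <= q <= 1 -> avoid q s G <= 1.
Proof.
move=> /andP[q0 q1]; apply: prodr_ile1 => F _.
by case: (F \subset G); rewrite ?mulr1 ?mulr0 ?subr0 ?subr_ge0 ?q1 ?gerBl ?ler01 ?lexx.
Qed.

Lemma avoid_dec q s F G : 0 <= q <= 1 -> avoid q s (F :|: G) <= avoid q s G.
Proof.
move=> /andP[q0 q1]; apply: ler_prod => A _.
have [AG|] := boolP (A \subset G).
  by rewrite (fintype.subset_trans AG (finset.subsetUr _ _)) lexx mulr1 subr_ge0 q1.
by case: (A \subset F :|: G); rewrite ?mulr1 ?mulr0 ?subr0 ?subr_ge0 ?q1 ?gerBl ?ler01 ?lexx.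
Qed.

Definition dep F s := [seq A : {set T} <- s | ~~ [disjoint A & F]].
Definition indep F s := [seq A : {set T} <- s | [disjoint A & F]].

(** The new factor is [1 - q] when [F \subset G] and 1 otherwise, so a lower bound on the weighted
    probability of [F \subset G] is needed. Members of [s] disjoint from [F] are independent of it;
    those meeting [F] are removed by a union bound, whose terms Harris controls. *)
Lemma janson_step q s F : 0 <= q <= 1 -> F \subset E ->
  {in s, forall A : {set T}, A \subset E} ->
  expect E p (avoid q (F :: s)) <=
  expect E p (avoid q s) *
    expR (- (q * (p ^+ #|F| - q * \sum_(A <- dep F s) p ^+ #|A :|: F|))).
Proof.
move=> q01 FE sE; have [q0 q1] := andP q01; have p0 : 0 <= p by case/andP: p01.
set x := p ^+ _ - _.
have E0 : 0 <= expect E p (avoid q s) by apply: expect_ge0 => // G _; exact: avoid_ge0.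
have avoidE G : avoid q s G = avoid q (dep F s) G * avoid q (indep F s) G.
  rewrite /avoid !big_filter [LHS](bigID (fun A : {set T} => ~~ [disjoint A & F])) /=.
  by congr (_ * _); apply: eq_bigl => A; rewrite negbK.
(* The union bound in weighted form: a product of factors [1 - a] is at least one minus the sum of
   the [a]. *)
have dep_ge G : 1 - q * \sum_(A <- dep F s) (A \subset G)%:R <= avoid q (dep F s) G.
  rewrite /avoid; elim: (dep F s) => [|A t IH]; first by rewrite !big_nil mulr0 subr0.
  rewrite !big_cons; have t0 : 0 <= \sum_(j <- t) (j \subset G)%:R :> R.
    by rewrite sumr_ge0.
  have t1 := avoid_le1 t G q01.
  case: (A \subset G); rewrite ?mulr0 ?subr0 ?mul1r ?add0r //= !mulr1.
  rewrite -/(avoid q t G) in IH t1 *; nra.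
have key : x * expect E p (avoid q s) <=
    expect E p (fun G => (F \subset G)%:R * avoid q s G).
  (* For [x <= 0] the claim is trivial; for [x > 0] the weight of [s] may be replaced by the larger
     weight of [indep F s]. *)
  have [x0|x0] := leP x 0.
    apply: (@le_trans _ _ 0); first by rewrite mulr_le0_ge0.
    by apply: expect_ge0 => // G _; rewrite mulr_ge0 // avoid_ge0.
  have lind : expect E p (avoid q s) <= expect E p (avoid q (indep F s)).
    apply: ler_expect => // G _; rewrite avoidE ler_piMl ?avoid_ge0 //.
    exact: avoid_le1.
  apply: (le_trans (ler_wpM2l (ltW x0) lind)).
  (* A set disjoint from [F] lies in [F :|: G] exactly when it lies in [G], so this factorisation is
     an equality. *)
  have indepF : expect E p (fun G => (F \subset G)%:R * avoid q (indep F s) G) =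
      p ^+ #|F| * expect E p (avoid q (indep F s)).
    rewrite expect_mem //; congr (_ * _); apply: eq_expect => G _.
    apply: eq_big_seq => A; rewrite mem_filter => /andP[AF _].
    by rewrite -subDset (setDidPl AF).
  have depF A : A \in dep F s ->
      expect E p (fun G => (A :|: F \subset G)%:R * avoid q (indep F s) G) <=
      p ^+ #|A :|: F| * expect E p (avoid q (indep F s)).
    rewrite mem_filter => /andP[_ /sE AE]; apply: harris_subset.
      by rewrite subUset AE.
    by move=> G _; apply: avoid_dec.
  rewrite /x mulrBl -indepF lerBlDr.
  apply: (@le_trans _ _ (expect E p (fun G => (F \subset G)%:R * avoid q s G) +
     q * \sum_(A <- dep F s) expect E p (fun G => (A :|: F \subset G)%:R * avoid q (indep F s) G))); last first.
    rewrite lerD2l -mulrA; apply: ler_wpM2l => //; rewrite mulr_suml.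
    by rewrite big_seq [leRHS]big_seq; apply: ler_sum => A; exact: depF.
  have expect_seq (t : seq {set T}) (g : {set T} -> {set T} -> R) :
      \sum_(A <- t) expect E p (g A) = expect E p (fun G => \sum_(A <- t) g A G).
    elim: t => [|A t IH].
      by rewrite big_nil /expect big1 // => G _; rewrite big_nil mulr0.
    by rewrite big_cons IH -expectD; apply: eq_expect => G _; rewrite big_cons.
  rewrite expect_seq -expectZ -expectD; apply: ler_expect => // G _.
  have H : (F \subset G)%:R * (1 - q * \sum_(A <- dep F s) (A \subset G)%:R) *
      avoid q (indep F s) G <= (F \subset G)%:R * avoid q s G.
    by rewrite avoidE -mulrA; apply: ler_wpM2l => //; apply: ler_wpM2r (dep_ge G); exact: avoid_ge0.
  rewrite -lerBlDr; apply: le_trans H.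
  have -> : \sum_(A <- dep F s) (A :|: F \subset G)%:R * avoid q (indep F s) G =
      (\sum_(A <- dep F s) (A \subset G)%:R) * (F \subset G)%:R * avoid q (indep F s) G.
    rewrite !mulr_suml; apply: eq_bigr => A _.
    by rewrite subUset -mulnb natrM.
  by rewrite le_eqVlt; apply/orP; left; apply/eqP; ring.
apply: (@le_trans _ _ (expect E p (avoid q s) * (1 - q * x))); last first.
  by apply: ler_wpM2l => //; exact: expR_ge1Dx.
rewrite (_ : expect E p (avoid q (F :: s)) = expect E p (avoid q s) +
   (- q) * expect E p (fun G => (F \subset G)%:R * avoid q s G)).
  by have := ler_wpM2l q0 key; nra.
rewrite -expectZ -expectD; apply: eq_expect => G _.
by rewrite /avoid big_cons; ring.
Qed.

(** Iterate [janson_step] along an enumeration of [P]; the exponents add up. Keeping [q] free lets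
    thinning offset a large [delta]. *)
Lemma janson (I : finType) (P : pred I) (F : I -> {set T}) q delta :
  0 <= q <= 1 -> (forall i, P i -> F i \subset E) ->
  (forall i, P i ->
    \sum_(j | [&& P j, j != i & ~~ [disjoint F j & F i]]) p ^+ #|F j :|: F i|
      <= delta * p ^+ #|F i|) ->
  prob E p (fun G => [forall i, P i ==> ~~ (F i \subset G)]) <=
  expR (- (q * (1 - q * delta) * \sum_(i | P i) p ^+ #|F i|)).
Proof.
move=> q01 FE FD; have [q0 q1] := andP q01.
pose s := enum P.
have [sP us] : {subset s <= P} /\ uniq s.
  by split; [move=> i; rewrite mem_enum | exact: enum_uniq].
have -> : \sum_(i | P i) p ^+ #|F i| = \sum_(i <- s) p ^+ #|F i|.
  by rewrite big_enum.
apply: (@le_trans _ _ (expect E p (avoid q (map F s)))).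
  apply: ler_expect => // G _; case: forallP => [none|_]; last exact: avoid_ge0.
  rewrite /avoid big_map big_seq big1 // => i /sP Pi.
  by have := none i; rewrite [P i]Pi /= => /negPf ->; rewrite mulr0 subr0.
elim: s sP us => [|i s IH] sP us.
  rewrite big_nil mulr0 oppr0 expR0 -(expect1 E p).
  by apply: ler_expect => // G _; rewrite /avoid /= big_nil.
have sP' : {subset s <= P} by move=> j js; apply: sP; rewrite inE js orbT.
have Pi : P i by apply: sP; rewrite inE eqxx.
case/andP: us => i_s us.
apply: (le_trans (janson_step q01 (FE _ Pi) _)).
  by move=> A /mapP[j /sP' Pj ->]; exact: FE.
apply: (le_trans (ler_wpM2r (expR_ge0 _) (IH sP' us))).
rewrite -expRD ler_expR big_cons.
set D := \sum_(A <- dep _ _) _; set a := p ^+ _; set S := \sum_(j <- s) _.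
suff : q * D <= q * (delta * a) by move=> /(ler_wpM2l q0); lra.
apply: ler_wpM2l => //; apply: le_trans (FD _ Pi).
(* [D] only involves the indices after [i] in the enumeration, so the full sum over [j] dominates
   it. *)
rewrite /D big_filter big_map -big_filter big_uniq ?filter_uniq //=.
rewrite [leLHS]big_mkcond [leRHS]big_mkcond; apply: ler_sum => j _.
rewrite mem_filter; case: (boolP (j \in s)) => js; rewrite ?andbT ?andbF.
  by rewrite [P j]sP' // (_ : j != i) //; apply: contraNneq i_s => <-.
by case: ifP => // _; rewrite exprn_ge0 //; case/andP: p01.
Qed.

End Janson.

(** * Cliques in small vertex sets *)

Lemma leq_ffact_exp n m : (n ^_ m <= n ^ m)%N.
Proof.
elim: m => [|m IH]; first by rewrite ffactn0 expn0.
by rewrite ffactnSr expnSr leq_mul // leq_subr.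
Qed.

Lemma leq_bin_exp n m : ('C(n, m) <= n ^ m)%N.
Proof.
apply: leq_trans (leq_ffact_exp n m).
by rewrite -bin_ffact leq_pmulr // fact_gt0.
Qed.

Lemma leq_exp_ffact n m : ((n - m) ^ m <= n ^_ m)%N.
Proof.
suff H j : (j <= m -> (n - m) ^ j <= n ^_ j)%N by exact: H.
elim: j => [|j IH] jm; first by rewrite ffactn0 expn0.
rewrite ffactnSr expnSr leq_mul ?IH ?(ltnW jm) //.
by rewrite leq_sub2l // ltnW.
Qed.

Lemma bin2_mul2 k : ('C(k, 2) * 2 = k * k.-1)%N.
Proof. by rewrite -[2%N]/(2`!) bin_ffact ffactnS ffactn1. Qed.

(** Both sides are [(k - j) * (k + j - 1)]. The part [k * (k - j)] will supply a factor [w ^+ k] for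
    each of the [k - j] vertices outside an intersection of size [j]. *)
Lemma bin2_sub_mul2 k j : (0 < j < k)%N ->
  (2 * ('C(k, 2) - 'C(j, 2)) = k * (k - j) + j.-1 * (k - j))%N.
Proof.
rewrite mulnC mulnBl !bin2_mul2; case: j k => [|j] [|k] //= jk.
by rewrite ltnS in jk; rewrite -(subnKC (ltnW jk)) subSS addKn; nia.
Qed.

Section Cliques.
Variable n : nat.
Implicit Types (G : {set {set 'I_n}}) (K S J : {set 'I_n}).

Definition inner_pairs K : {set {set 'I_n}} := [set e in pairs n | e \subset K].

Lemma inner_pairs_sub K : inner_pairs K \subset pairs n.
Proof. by apply/fintype.subsetP => e; rewrite inE => /andP[]. Qed.

Lemma card_inner_pairs K : #|inner_pairs K| = 'C(#|K|, 2).
Proof.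
rewrite -cards_draws; apply: eq_card => e; rewrite !inE andbC //.
Qed.

Lemma inner_pairsI K S : inner_pairs K :&: inner_pairs S = inner_pairs (K :&: S).
Proof. by apply/setP => e; rewrite !inE finset.subsetI; case: (#|e| == 2)%N. Qed.

Lemma clique_copyE r G K :
  clique_copy r G K = (#|K| == r) && (inner_pairs K \subset G).
Proof.
congr (_ && _); apply/'forall_implyP/fintype.subsetP => [cK e|sG u uK].
  rewrite !inE => /andP[/cards2P[u [v [uv ->]]]]; rewrite subUset !sub1set => /andP[uK vK].
  by have /forall_inP/(_ _ vK) := cK _ uK; rewrite uv.
apply/forall_inP => v vK; apply/implyP => uv; apply: sG.
by rewrite !inE cards2 uv subUset !sub1set uK vK.
Qed.

(** Once its trace [J] on [K] is fixed, [K'] is determined by [K' :\: K], a subset of [S] with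
    [k - #|J|] elements. *)
Lemma card_clique_extensions k S K J : 
  (#|[set K' : {set 'I_n} | [&& K' \subset S, #|K'| == k & K' :&: K == J]]| <= #|S| ^ (k - #|J|))%N.
Proof.
apply: leq_trans (leq_bin_exp _ _); rewrite -cards_draws.
pose A := [set K' : {set 'I_n} | [&& K' \subset S, #|K'| == k & K' :&: K == J]].
have inj : {in A &, injective (fun K' : {set 'I_n} => K' :\: K)}.
  move=> K1 K2; rewrite !inE => /and3P[_ _ /eqP J1] /and3P[_ _ /eqP J2] E.
  by rewrite -(setID K1 K) -(setID K2 K) J1 J2 E.
rewrite -(card_in_imset inj); apply: subset_leq_card.
apply/fintype.subsetP => _ /imsetP[K' /[!inE] /and3P[K'S /eqP K'k /eqP K'J] ->].
rewrite (fintype.subset_trans (subsetDl _ _) K'S) /=.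
by rewrite -K'J -K'k -(cardsID K K') addKn.
Qed.

End Cliques.

Section CliqueFreeSets.
Variables (R : realType) (n k : nat) (w L : R).
Hypotheses (k2 : (2 <= k)%N) (w01 : 0 < w <= 1) (L1 : 1 <= L).

Let p : R := w ^+ 2.

Let p01 : 0 <= p <= 1.
Proof. by case/andP: w01 => /ltW w0 w1; rewrite /p exprn_ge0 ?exprn_ile1. Qed.

(** The [delta] fed to [janson]: at most [2 ^+ k] intersections with a given clique, each of
    relative weight at most [(2 * L) ^+ (k - 2)]. *)
Let Q : R := 2 ^+ k * (2 * L) ^+ (k - 2).

(* The exponent of w in the left-hand side is k(k-1) - j(j-1), which is at
   least k(k-j), so that [s * w ^+ k <= 2 * L] absorbs every factor [s]. *)
Lemma clique_pair_weight (s j : nat) : s%:R * w ^+ k <= 2 * L -> (2 <= j < k)%N ->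
  s%:R ^+ (k - j) * p ^+ ('C(k, 2) - 'C(j, 2)) <= (2 * L) ^+ (k - 2).
Proof.
move=> sw /andP[j2 jk]; have /andP[/ltW w0 w1] := w01.
have L2 : 1 <= 2 * L by have := L1; lra.
have -> : p ^+ ('C(k, 2) - 'C(j, 2)) = w ^+ (k * (k - j)) * w ^+ (j.-1 * (k - j)).
  rewrite -exprM -exprD; congr (_ ^+ _).
  by rewrite bin2_sub_mul2 // jk (ltnW j2).
rewrite mulrA exprM -exprMn; apply: (@le_trans _ _ ((s%:R * w ^+ k) ^+ (k - j))).
  have sw0 : 0 <= s%:R * w ^+ k by rewrite mulr_ge0 ?exprn_ge0.
  by rewrite ler_piMr ?exprn_ile1 ?exprn_ge0.
apply: (@le_trans _ _ ((2 * L) ^+ (k - j))).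
  by apply: lerXn2r; rewrite ?nnegrE ?mulr_ge0 ?exprn_ge0 //; lra.
by rewrite ler_weXn2l // leq_sub2l.
Qed.

(** With [s = #|S|], the expected number of k-cliques in [S] is of order
    [s * (s * w ^+ k) ^+ (k - 1)], hence at least of order [s * L ^+ (k - 1)]. Dependence costs the
    factor [Q], of order [L ^+ (k - 2)], which leaves [s * L] in the exponent. *)
Lemma prob_no_clique (S : {set 'I_n}) :
  L <= #|S|%:R * w ^+ k <= 2 * L -> (2 * k <= #|S|)%N ->
  prob (pairs n) p (fun G => [forall K : {set 'I_n}, (K \subset S) ==> ~~ clique_copy k G K])
  <= expR (- (#|S|%:R * L / (k`!%:R * 8 ^+ k))).
Proof.
move=> /andP[Ls sL] ks; have /andP[w0 w1] := w01; have L1' := L1; set s := #|S| in Ls sL ks *.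
have p0 : 0 <= p by case/andP: p01.
have Q1 : 1 <= Q.
  by rewrite -[leLHS]mulr1 ler_pM // exprn_ege1 //; lra.
have Q0 : 0 < Q by lra.
pose P (K : {set 'I_n}) := (K \subset S) && (#|K| == k).
have -> : prob (pairs n) p (fun G => [forall K : {set 'I_n}, (K \subset S) ==> ~~ clique_copy k G K]) =
    prob (pairs n) p (fun G => [forall K, P K ==> ~~ (inner_pairs K \subset G)]).
  apply: eq_expect => G _; congr (nat_of_bool _)%:R; apply: eq_forallb => K.
  by rewrite clique_copyE /P; case: (K \subset S); case: (#|K| == k).
(* This [q] maximises [q * (1 - q * Q)], with value [1 / (4 * Q)]. *)
have q01 : 0 <= (2 * Q)^-1 <= 1.
  by rewrite invr_ge0 invf_le1; [apply/andP; split|]; lra.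
apply: le_trans (janson p01 (delta := Q) q01 _ _) _ => [K _|K|].
- exact: inner_pairs_sub.
- move=> /andP[KS /eqP Kk]; rewrite card_inner_pairs Kk.
  (* Group the cliques by their intersection [J] with [K]: sharing a pair gives [2 <= #|J|], and
     being distinct from [K] gives [#|J| < k]. *)
  rewrite (partition_big (fun K' => K' :&: K)
      (fun J : {set 'I_n} => (J \subset K) && (2 <= #|J| < k)%N)) /=; last first.
    move=> K' /and3P[/andP[_ /eqP K'k] K'K meet]; rewrite finset.subsetIr /=.
    apply/andP; split.
      move: meet; rewrite -setI_eq0 inner_pairsI => /set0Pn[e].
      by rewrite !inE => /andP[/eqP e2 /subset_leq_card]; rewrite e2.
    rewrite ltn_neqAle -{2}Kk subset_leq_card ?finset.subsetIr // andbT.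
    apply: contra K'K => /eqP JK.
    have/eqP KJ : K' :&: K == K by rewrite eqEcard finset.subsetIr JK Kk leqnn.
    by rewrite eq_sym eqEcard -{1}KJ finset.subsetIl K'k Kk leqnn.
  apply: (@le_trans _ _ (\sum_(J in powerset K) (2 * L) ^+ (k - 2) * p ^+ 'C(k, 2))); last first.
    by rewrite sumr_const card_powerset Kk -[leLHS]mulr_natl natrX /Q mulrA.
  rewrite [leLHS]big_mkcond [leRHS]big_mkcond /=; apply: ler_sum => J _.
  have rhs0 : 0 <= (2 * L) ^+ (k - 2) * p ^+ 'C(k, 2).
    by rewrite mulr_ge0 ?exprn_ge0 //; lra.
  rewrite powersetE; case: (J \subset K) => //=; case: ifP => // J2k.
  apply: (@le_trans _ _ (\sum_(K' in [set K' : {set 'I_n} |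
      [&& K' \subset S, #|K'| == k & K' :&: K == J]])
      p ^+ ('C(k, 2) - 'C(#|J|, 2)) * p ^+ 'C(k, 2))).
    rewrite [leLHS]big_mkcond [leRHS]big_mkcond /=; apply: ler_sum => K' _.
    rewrite inE /P; case: (K' \subset S) => //=.
    case: (boolP (#|K'| == k)) => //= /eqP K'k.
    case: (boolP (K' :&: K == J)) => [/eqP KJ|_]; rewrite ?andbF // andbT.
    case: (_ && _); last by apply: mulr_ge0; apply: exprn_ge0.
    rewrite -exprD cardsU inner_pairsI.
    rewrite !card_inner_pairs KJ K'k Kk addnC addnBA //.
    by rewrite leq_bin2l //; case/andP: J2k => _ /ltnW.
  rewrite sumr_const -[leLHS]mulr_natl mulrA; apply: ler_wpM2r; first by rewrite exprn_ge0.
  apply: le_trans (clique_pair_weight sL J2k); apply: ler_wpM2r; first by rewrite exprn_ge0.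
  by rewrite -natrX ler_nat card_clique_extensions.
rewrite ler_expR lerN2.
have -> : \sum_(K | P K) p ^+ #|inner_pairs K| = 'C(s, k)%:R * p ^+ 'C(k, 2).
  rewrite (eq_bigr (fun=> p ^+ 'C(k, 2))) => [|K /andP[_ /eqP Kk]]; last first.
    by rewrite card_inner_pairs Kk.
  rewrite sumr_const -cards_draws mulr_natl; congr (_ *+ _).
  by apply: eq_card => K; rewrite !inE.
(* Since [2 * k <= s], every factor of the falling factorial is at least [s / 2]. *)
have bins : (s%:R / 2) ^+ k <= 'C(s, k)%:R * k`!%:R :> R.
  rewrite -natrM bin_ffact; apply: le_trans (_ : ((s - k) ^ k)%:R <= _); last first.
    by rewrite ler_nat leq_exp_ffact.
  rewrite natrX; apply: lerXn2r; rewrite ?nnegrE ?divr_ge0 // natrB; last first.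
    by apply: leq_trans ks; rewrite leq_pmull.
  have : (2 * k)%:R <= s%:R :> R by rewrite ler_nat.
  by rewrite natrM; lra.
have -> : (2 * Q)^-1 * (1 - (2 * Q)^-1 * Q) * ('C(s, k)%:R * p ^+ 'C(k, 2)) =
    'C(s, k)%:R * p ^+ 'C(k, 2) / (4 * Q) by field; rewrite gt_eqF.
have kf : 0 < k`!%:R :> R by rewrite ltr0n fact_gt0.
have s0 : 0 <= s%:R :> R by [].
have Q4 : 0 < 4 * Q by lra.
rewrite ler_pdivlMr // mulrAC ler_pdivrMr ?mulr_gt0 ?exprn_gt0 //.
have -> : p ^+ 'C(k, 2) = w ^+ (k * k.-1) by rewrite -exprM -bin2_mul2 mulnC.
apply: (@le_trans _ _ ((s%:R / 2) ^+ k * w ^+ (k * k.-1) * 8 ^+ k)); last first.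
  have -> : 'C(s, k)%:R * w ^+ (k * k.-1) * (k`!%:R * 8 ^+ k) =
     'C(s, k)%:R * k`!%:R * w ^+ (k * k.-1) * 8 ^+ k by ring.
  by rewrite !ler_wpM2r ?exprn_ge0 // ltW.
(* With [k = m + 2], the factor [8 ^+ k] exactly absorbs the powers of 2 from [bins] and from
   [4 * Q], and [Lm] is all that remains. *)
rewrite exprM /Q; case: k k2 => [|[|m]] // _ in Ls *.
rewrite subSS subn1 /= in Ls *.
have Lm : L ^+ m.+1 <= (s%:R * w ^+ m.+2) ^+ m.+1.
  by apply: lerXn2r; rewrite // nnegrE; lra.
have -> : s%:R * L * (4 * (2 ^+ m.+2 * (2 * L) ^+ m)) = s%:R * L ^+ m.+1 * 4 ^+ m.+2.
  rewrite exprMn (_ : (4 : R) = 2 * 2); last by ring.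
  by rewrite [(2 * 2) ^+ _]exprMn !exprS; ring.
have -> : (s%:R / 2) ^+ m.+2 * (w ^+ m.+2) ^+ m.+1 * 8 ^+ m.+2 =
    s%:R * (s%:R * w ^+ m.+2) ^+ m.+1 * 4 ^+ m.+2 :> R.
  have -> : (8 : R) = 2 * 4 by ring.
  by rewrite !exprMn exprVn [s%:R ^+ m.+2]exprS; field; rewrite expf_neq0.
by rewrite ler_wpM2r ?ler_wpM2l ?exprn_ge0.
Qed.

End CliqueFreeSets.

(** * Upper bound on the number of orientations *)

Lemma finfun_inj (aT : finType) (rT : Type) (f g : aT -> rT) :
  finfun f = finfun g -> f =1 g.
Proof. by move=> fg x; rewrite -(ffunE f) fg ffunE. Qed.

(** * Minimal generating sets of closed sets *)

Section GeneratingSets.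
Variables (T : finType) (h : rel T).
Implicit Types M O : {set T}.

Definition upset M : {set T} := [set y | [exists x in M, connect h x y]].

(** Take [M] minimal among the sets generating [O]. If [h x y] held for distinct [x], [y] in [M],
    then [y] could be dropped, as [x] reaches everything that [y] reaches. *)
Lemma independent_generators O :
  (forall x y, x \in O -> h x y -> y \in O) ->
  exists2 M : {set T}, M \subset O &
    upset M = O /\ {in M &, forall x y, x != y -> ~~ h x y}.
Proof.
move=> Oh.
have OO : upset O == O.
  apply/eqP/setP => y; rewrite inE; apply/exists_inP/idP => [[x xO /connectP[p]]|yO].
    elim: p x xO => [|z p IH] x xO /= => [_ -> //|/andP[xz]].
    by apply: IH; apply: Oh xz.
  by exists y.
have [M /minsetP[/eqP MO Mmin] subMO] := minset_exists (P := fun M => upset M == O) OO.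
exists M => //; split => // x y xM yM xy; apply/negP => hxy.
have : M :\ y = M.
  apply: Mmin; last exact: subD1set.
  rewrite -MO; apply/eqP/setP => z; rewrite !inE.
  apply/exists_inP/exists_inP => -[u uM uz].
    by exists u => //; move: uM; rewrite !inE => /andP[].
  have [uy|uy] := eqVneq u y; last by exists u; rewrite ?inE ?uy.
  exists x; first by rewrite !inE xy.
  by apply: connect_trans (connect1 hxy) _; rewrite -uy.
by move/setP/(_ y); rewrite !inE eqxx yM.
Qed.

End GeneratingSets.

Lemma eq_upset (T : finType) (h1 h2 : rel T) : h1 =2 h2 -> upset h1 =1 upset h2.
Proof.
move=> h12 M; apply/setP => y; rewrite !inE.
by apply: eq_existsb => x; rewrite (eq_connect h12).
Qed.

(** * Sources and sinks for reachability in tournaments *)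

Section Tournaments.
Variable T : finType.
Implicit Types (e : rel T) (K : {set T}).

Definition within K e : rel T := [rel x y | [&& x \in K, y \in K & e x y]].

(** Choose [x] reaching the most vertices. An unreached [y] would have an arc to [x], and so would
    reach all that [x] reaches and also itself. *)
Lemma tournament_source e K z : z \in K ->
  {in K &, forall x y, x != y -> e x y || e y x} ->
  exists2 x, x \in K & {in K, forall y, connect (within K e) x y}.
Proof.
move=> zK tot; pose reach x := #|[set y | connect (within K e) x y]|.
have [x xK xmax] := @arg_maxnP _ z (fun x => x \in K) reach zK.
exists x => // y yK; apply/negPn/negP => nxy.
have yx : within K e y x.
  rewrite /within /= xK yK /=; have := tot x y xK yK.
  case: eqVneq => [xy|_ /(_ isT) /orP[exy|//]].
    by rewrite -xy connect0 in nxy.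
  by rewrite connect1 // /within /= xK yK exy in nxy.
have := xmax y yK; rewrite /= leqNgt => /negP; apply; apply: proper_card.
apply/properP; split.
  apply/fintype.subsetP => u; rewrite !inE; apply: connect_trans; exact: connect1.
by exists y; rewrite inE ?connect0.
Qed.

Lemma tournament_source_sink e K : (1 < #|K|)%N ->
  {in K &, forall x y, x != y -> e x y || e y x} ->
  exists x y, [/\ x \in K, y \in K, x != y,
    {in K, forall z, connect (within K e) x z} &
    {in K, forall z, connect (within K e) z y}].
Proof.
move=> K1 tot; have /card_gt0P[z zK] : (0 < #|K|)%N by exact: ltnW.
have [x xK xs] := tournament_source zK tot.
have tot' : {in K &, forall x y, x != y -> [rel x y | e y x] x y || [rel x y | e y x] y x}.
  by move=> u v uK vK uv /=; rewrite orbC tot.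
have [y yK ys] := tournament_source zK tot'.
have {}ys : {in K, forall u, connect (within K e) u y}.
  move=> u /ys; have /= <- := connect_rev (within K e) y u.
  by apply: connect_sub => a b /= /and3P[aK bK eba]; apply: connect1; rewrite /within /= aK bK.
(* If source and sink coincide, all vertices of [K] reach one another, and any second vertex can
   serve as the sink. *)
have [xy|xy] := eqVneq x y; last by exists x, y.
have /card_gt0P[u] : (0 < #|K :\ x|)%N by move: K1; rewrite (cardsD1 x) xK.
rewrite !inE => /andP[ux uK]; exists x, u; split => //; first by rewrite eq_sym.
by move=> v vK; apply: connect_trans (ys v vK) _; rewrite -xy; exact: xs.
Qed.

End Tournaments.

(** * Encoding orientations by small generating sets *)

Section UpperBound.
Variables (n r s : nat) (G : {set {set 'I_n}}).
Hypotheses (r3 : (3 <= r)%N) (GE : G \subset pairs n).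
Hypothesis clique_in : forall S : {set 'I_n}, #|S| = s ->
  exists2 K : {set 'I_n}, K \subset S & clique_copy r.-1 G K.
Implicit Types (D : {set 'I_n * 'I_n}) (u v x y : 'I_n) (K M S : {set 'I_n}).

Let arc D : rel 'I_n := [rel x y | (x, y) \in D].

Lemma adj_neq u v : adj G u v -> u != v.
Proof.
move=> /(fintype.subsetP GE); by rewrite inE cards2; case: (u != v).
Qed.

Lemma orientation_arc D u v : orientation G D -> adj G u v ->
  ((u, v) \in D) (+) ((v, u) \in D).
Proof. by move=> /forallP/(_ u)/forallP/(_ v); case: ifP. Qed.

Lemma clique_tournament D k K : orientation G D -> clique_copy k G K ->
  {in K &, forall x y, x != y -> arc D x y || arc D y x}.
Proof.
move=> oD /andP[_ /forall_inP cK] x y xK yK xy.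
have := orientation_arc oD (implyP (forall_inP (cK x xK) y yK) xy).
by rewrite /arc /=; case: ((x, y) \in D).
Qed.

Definition earlier v : {set 'I_n} := [set u : 'I_n | (u < v)%N && adj G u v].
Definition out_earlier D v : {set 'I_n} := [set u in earlier v | (v, u) \in D].

(* If x reaches all of K and all of K reaches y, then v -> x and y -> v would
   make K + v strongly connected: v -> x forces v -> y. *)
Definition forces D v : rel 'I_n := [rel x y |
  [exists K : {set 'I_n}, [&& K \subset earlier v, clique_copy r.-1 G K,
    x \in K, y \in K, [forall z in K, connect (within K (arc D)) x z]
    & [forall z in K, connect (within K (arc D)) z y]]]].

Lemma out_earlier_closed D v x y : orientation G D ->
  (forall K, clique_copy r G K -> ~~ strongly_connected D K) ->
  x \in out_earlier D v -> forces D v x y -> y \in out_earlier D v.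
Proof.
move=> oD noK; rewrite inE => /andP[xv vx] /existsP[K].
move=> /and5P[Kv cK xK yK /andP[/forall_inP xs /forall_inP ys]].
rewrite inE (fintype.subsetP Kv _ yK) /=; apply/negPn/negP => nvy.
have vK : v \notin K.
  by apply/negP => /(fintype.subsetP Kv); rewrite inE ltnn.
have adjv u : u \in K -> adj G u v.
  by move=> /(fintype.subsetP Kv); rewrite inE => /andP[].
have yv : (y, v) \in D.
  by have := orientation_arc oD (adjv _ yK); rewrite (negPf nvy) addbF.
have cvK : clique_copy r G (v |: K).
  have /andP[/eqP cardK /forall_inP Kadj] := cK.
  apply/andP; split; first by rewrite cardsU1 vK cardK add1n prednK //; exact: leq_trans r3.
  apply/forall_inP => a aK; apply/forall_inP => b bK; apply/implyP => ab.
  move: aK bK ab; rewrite !inE.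
  case/predU1P=> [->|aK]; case/predU1P=> [->|bK]; rewrite ?eqxx // => ab.
  - by rewrite /adj finset.setUC; exact: adjv.
  - exact: adjv.
  - exact: (implyP (forall_inP (Kadj _ aK) _ bK)).
apply: (negP (noK _ cvK)).
pose eK := [rel a b | [&& a \in v |: K, b \in v |: K & (a, b) \in D]].
have lift a b : connect (within K (arc D)) a b -> connect eK a b.
  apply: connect_sub => c d /and3P[cK' dK cd]; apply: connect1.
  by rewrite /= !inE cK' dK !orbT; exact: cd.
have to_v a : a \in v |: K -> connect eK a v.
  rewrite !inE => /predU1P[->|aK]; first exact: connect0.
  apply: connect_trans (lift _ _ (ys _ aK)) _; apply: connect1.
  by rewrite /= !inE eqxx yK yv orbT.
have from_v a : a \in v |: K -> connect eK v a.
  rewrite !inE => /predU1P[->|aK]; first exact: connect0.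
  apply: connect_trans (lift _ _ (xs _ aK)); apply: connect1.
  by rewrite /= !inE eqxx xK vx orbT.
apply/forall_inP => a aK; apply/forall_inP => b bK.
exact: connect_trans (to_v a aK) (from_v b bK).
Qed.

(** A larger [M] would contain [s] vertices, hence a clique on [r.-1] vertices, hence a distinct
    source and sink of that clique, the first forcing the second. *)
Lemma independent_small D v M : orientation G D -> M \subset earlier v ->
  {in M &, forall x y, x != y -> ~~ forces D v x y} -> (#|M| <= s)%N.
Proof.
move=> oD Mv indep; rewrite leqNgt; apply/negP => sM.
have [S SM cardS] : exists2 S : {set 'I_n}, S \subset M & #|S| = s.
  have : (0 < #|[set S : {set 'I_n} | S \subset M & #|S| == s]|)%N by rewrite cards_draws bin_gt0 ltnW.
  by case/card_gt0P => S; rewrite inE => /andP[SM /eqP]; exists S.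
have [K KS cK] := clique_in cardS.
have K1 : (1 < #|K|)%N by case/andP: cK => /eqP -> _; lia.
have [x [y [xK yK xy xs ys]]] := tournament_source_sink K1 (clique_tournament oD cK).
have KM := fintype.subset_trans KS SM.
have /negP := indep x y (fintype.subsetP KM _ xK) (fintype.subsetP KM _ yK) xy; apply.
apply/existsP; exists K; rewrite (fintype.subset_trans KM Mv) cK xK yK /=.
by apply/andP; split; apply/forall_inP.
Qed.

(** Forcing at [v] only looks at arcs between vertices before [v]; this is what makes decoding
    vertex by vertex possible. *)
Lemma eq_forces D1 D2 v :
  (forall a b : 'I_n, (a < v)%N -> (b < v)%N -> ((a, b) \in D1) = ((a, b) \in D2)) ->
  forces D1 v =2 forces D2 v.
Proof.
move=> D12 x y; apply: eq_existsb => K; case: (boolP (K \subset earlier v)) => //= Kv.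
have Kw : within K (arc D1) =2 within K (arc D2).
  move=> a b; rewrite /within /=.
  case: (boolP (a \in K)) => //= aK; case: (boolP (b \in K)) => //= bK.
  by apply: D12; [have := fintype.subsetP Kv _ aK | have := fintype.subsetP Kv _ bK];
    rewrite inE => /andP[].
do 3! congr (_ && _).
by congr (_ && _); apply: eq_forallb => z; rewrite (eq_connect Kw).
Qed.

(** The default [finset.set0] is never reached for [D] in [good]: the proof of [codeP] shows that
    [pick] succeeds. *)
Definition code D v : {set 'I_n} :=
  odflt finset.set0 [pick M : {set 'I_n} |
    (#|M| <= s)%N && (upset (forces D v) M == out_earlier D v)].

Let good := [set D : {set 'I_n * 'I_n} | orientation G D &
   [forall K, clique_copy r G K ==> ~~ strongly_connected D K]].

Lemma codeP D v : D \in good ->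
  (#|code D v| <= s)%N /\ upset (forces D v) (code D v) = out_earlier D v.
Proof.
rewrite inE => /andP[oD /forallP noK]; rewrite /code; case: pickP => [M /andP[? /eqP]//|].
have closed x y : x \in out_earlier D v -> forces D v x y -> y \in out_earlier D v.
  by apply: out_earlier_closed => // K cK; have := noK K; rewrite cK.
have [M Mv [MO indep]] := independent_generators closed.
move=> /(_ M) /negP[]; rewrite MO eqxx andbT.
apply: independent_small oD _ indep; apply: fintype.subset_trans Mv _.
by apply/fintype.subsetP => u; rewrite inE => /andP[].
Qed.

(** Decode by induction on [m]: once the arcs among the vertices below [m] agree, so do the forcings
    at [m]; equal codes then generate the same out-neighbours of [m], which settles every arc
    between [m] and earlier vertices. *)
Lemma code_inj : {in good &, injective (fun D => finfun (code D))}.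
Proof.
move=> D1 D2 g1 g2 /finfun_inj code12.
have o1 : orientation G D1 by move: g1; rewrite inE => /andP[].
have o2 : orientation G D2 by move: g2; rewrite inE => /andP[].
have agree m : forall a b : 'I_n, (a < m)%N -> (b < m)%N -> ((a, b) \in D1) = ((a, b) \in D2).
  elim: m => // m IH.
  have back v u : v = m :> nat -> (u < m)%N -> ((v, u) \in D1) = ((v, u) \in D2).
    move=> vm um; case: (boolP (adj G v u)) => [vu|nvu]; last first.
      move: (forallP (forallP o1 v) u) (forallP (forallP o2 v) u).
      by rewrite (negPf nvu) => /negPf -> /negPf ->.
    have : out_earlier D1 v = out_earlier D2 v.
      rewrite -(proj2 (codeP v g1)) -(proj2 (codeP v g2)).
      rewrite code12.
      have D12 : forces D1 v =2 forces D2 v by apply: eq_forces; rewrite vm.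
      exact: eq_upset.
    by move/setP/(_ u); rewrite !inE vm um /= /adj finset.setUC -/(adj G v u) vu.
  move=> a b; rewrite !ltnS leq_eqVlt => /predU1P[am|am].
    rewrite leq_eqVlt => /predU1P[bm|bm]; last exact: back.
    have ab : a = b by apply: val_inj; rewrite /= am bm.
    rewrite ab; move: (forallP (forallP o1 b) b) (forallP (forallP o2 b) b).
    case: ifP => [/adj_neq|_ /negPf -> /negPf -> //]; by rewrite eqxx.
  rewrite leq_eqVlt => /predU1P[bm|bm]; last exact: IH.
  move: (forallP (forallP o1 a) b) (forallP (forallP o2 a) b).
  rewrite (back b a bm am); case: ifP => [_|_ /negPf -> /negPf -> //].
  by case: ((b, a) \in D2); case: ((a, b) \in D1); case: ((a, b) \in D2).
by apply/setP => -[a b]; exact: (agree n).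
Qed.

(** List the elements of [M] in [s] slots and pad with [None]; the padding value accounts for [n.+1]
    in place of [n]. *)
Lemma card_small_sets : (#|[set M : {set 'I_n} | (#|M| <= s)%N]| <= n.+1 ^ s)%N.
Proof.
pose im (g : {ffun 'I_s -> option 'I_n}) := [set x | Some x \in codom g].
have -> : (n.+1 ^ s)%N = #|{ffun 'I_s -> option 'I_n}|.
  by rewrite card_ffun card_option !card_ord.
apply: leq_trans (leq_imset_card im _); apply: subset_leq_card.
apply/fintype.subsetP => M; rewrite inE => Ms; apply/imsetP.
exists [ffun i : 'I_s => nth None (map Some (enum M)) i] => //.
apply/setP => x; rewrite inE -mem_enum; apply/idP/codomP => [xM|[i]].
  have lt : (index x (enum M) < s)%N.
    by apply: leq_trans Ms; rewrite cardE index_mem.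
  by exists (Ordinal lt); rewrite ffunE /= (nth_map x) ?index_mem // nth_index.
rewrite ffunE; case: (ltnP i (size (enum M))) => [iM|iM].
  by rewrite (nth_map x) // => -[->]; exact: mem_nth.
by rewrite nth_default // size_map.
Qed.

Lemma Sr_upper_bound : (Sr r G <= (n.+1 ^ s) ^ n)%N.
Proof.
rewrite /Sr -(card_in_imset code_inj).
apply: (@leq_trans #|ffun_on (mem [set M : {set 'I_n} | (#|M| <= s)%N]) : pred {ffun 'I_n -> {set 'I_n}}|).
  apply: subset_leq_card; apply/fintype.subsetP => _ /imsetP[D gD ->].
  by apply/ffun_onP => v; rewrite (ffunE (code D) v) inE; case: (codeP v gD).
rewrite card_ffun_on card_ord.
have leq_exp a c m : (a <= c -> a ^ m <= c ^ m)%N by case: m => // m; rewrite leq_exp2r.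
exact/leq_exp/card_small_sets.
Qed.

End UpperBound.

(** * Lower bound on the number of orientations *)

Lemma leq_card_bigcup (I T : finType) (P : pred I) (A : I -> {set T}) :
  (#|\bigcup_(i | P i) A i| <= \sum_(i | P i) #|A i|)%N.
Proof.
elim/big_rec2: _ => [|i m B _ IH]; first by rewrite cards0.
by apply: (leq_trans (leq_card_setU _ _)); rewrite leq_add2l.
Qed.

Section LowerBound.
Variables (n r : nat) (b : 'I_n -> nat).
Hypothesis r3 : (3 <= r)%N.
Implicit Types (G Z : {set {set 'I_n}}) (D : {set 'I_n * 'I_n}).
Implicit Types (u v x y : 'I_n) (K : {set 'I_n}).

Definition in_block K := [forall u in K, forall v in K, b u == b v].
Definition block_pairs : {set {set 'I_n}} := [set e in pairs n | in_block e].
Definition block_sets : {set {set 'I_n}} := [set K : {set 'I_n} | (#|K| == r) && in_block K].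

Definition free_pairs G : {set {set 'I_n}} := (G :&: block_pairs) :\:
  \bigcup_(K in block_sets | inner_pairs K \subset G) inner_pairs K.

(** The linear order by block first and index second; in [flipped], exactly the edges in [Z] run
    against it. *)
Definition before u v := (b u < b v)%N || (b u == b v) && (u < v)%N.

Definition flipped G Z : {set 'I_n * 'I_n} :=
  [set a : 'I_n * 'I_n | adj G a.1 a.2 && (before a.1 a.2 (+) ([set a.1; a.2] \in Z))].

Lemma before_total u v : u != v -> before u v = ~~ before v u.
Proof.
rewrite /before; case: (ltngtP (b u) (b v)) => //= _; rewrite -leqNgt => uv.
by rewrite ltn_neqAle uv.
Qed.

Lemma flipped_orientation G Z : G \subset pairs n -> orientation G (flipped G Z).
Proof.
move=> GE; apply/forallP => u; apply/forallP => v; case: ifPn => [uv|/negPf uv].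
  have vu : adj G v u by rewrite /adj finset.setUC.
  rewrite !inE /= uv vu /=.
  rewrite (before_total (adj_neq GE uv)) [[set v; u]]finset.setUC.
  by case: (before v u); case: (_ \in Z).
by rewrite inE /= uv.
Qed.

Lemma flipped_inj G : G \subset pairs n ->
  {in powerset (free_pairs G) &, injective (flipped G)}.
Proof.
move=> GE Z1 Z2; rewrite !powersetE => Z1F Z2F /setP Z12; apply/setP => e.
have sub Z : Z \subset free_pairs G -> e \in Z -> e \in G.
  by move=> /fintype.subsetP ZF /ZF; rewrite !inE => /andP[_ /andP[]].
case: (boolP (e \in G)) => [eG|eG]; last first.
  by rewrite (contraNF (sub _ Z1F)) // (contraNF (sub _ Z2F)).
have := fintype.subsetP GE _ eG; rewrite inE => /cards2P[u [v [uv ev]]].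
have := Z12 (u, v); rewrite !inE /= /adj -ev eG /=.
by case: (before u v); case: (e \in Z1); case: (e \in Z2).
Qed.

(** A function that never decreases along arcs never decreases along paths, so [y] cannot reach
    [x]. *)
Lemma not_strongly_connected D K (f : 'I_n -> nat) x y :
  {in K &, forall u v, (u, v) \in D -> f u <= f v}%N ->
  x \in K -> y \in K -> (f x < f y)%N -> ~~ strongly_connected D K.
Proof.
move=> mono xK yK xy; apply/negP => /forall_inP/(_ _ yK)/forall_inP/(_ _ xK).
case/connectP => p pK E; move: xy; rewrite {}E ltnNge => /negP; apply.
elim: p y pK {yK} => //= z p IH y /andP[/and3P[yK zK yz] /IH]; apply: leq_trans.
exact: mono.
Qed.

(** If [K] lies in one block, none of its pairs is free, so its arcs follow the index. Otherwise the
    block number is monotone along arcs and not constant on [K], because only pairs inside a block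
    are reversed. *)
Lemma flipped_no_strong_clique G Z K : Z \subset free_pairs G ->
  clique_copy r G K -> ~~ strongly_connected (flipped G Z) K.
Proof.
move=> /fintype.subsetP ZF; rewrite clique_copyE => /andP[/eqP Kr KG].
have [Kb|] := boolP (in_block K).
  have : (1 < #|K|)%N by rewrite Kr; lia.
  case/card_gt1P => x [y [xK yK]]; rewrite -(inj_eq val_inj) => xy.
  have mono : {in K &, forall u v, (u, v) \in flipped G Z -> u <= v}%N.
    move=> u v uK vK; rewrite inE /= => /andP[_].
    case: (boolP ([set u; v] \in Z)) => [/ZF|_]; last first.
      rewrite addbF /before (eqP (forall_inP (forall_inP Kb _ uK) _ vK)) ltnn eqxx.
      exact: ltnW.
    rewrite inE => /andP[/bigcupP nbad]; rewrite !inE => /andP[_ /andP[uv _]].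
    case: nbad; exists K; first by rewrite inE Kr eqxx Kb.
    by rewrite !inE uv subUset !sub1set uK vK.
  have [xy'|xy'] := ltnP x y; first exact: (not_strongly_connected mono xK yK).
  by apply: (not_strongly_connected mono yK xK); rewrite ltn_neqAle eq_sym xy.
rewrite negb_forall_in => /existsP[x /andP[xK]].
rewrite negb_forall_in => /existsP[y /andP[yK xy]].
have mono : {in K &, forall u v, (u, v) \in flipped G Z -> b u <= b v}%N.
  move=> u v uK vK; rewrite inE /= => /andP[_].
  case: (boolP ([set u; v] \in Z)) => [/ZF|_]; last first.
    by rewrite addbF /before => /orP[/ltnW //|/andP[/eqP ->]].
  rewrite !inE => /andP[_ /and3P[_ _ uvb]] _.
  by rewrite (eqP (forall_inP (forall_inP uvb u _) v _)) // !inE eqxx ?orbT.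
have [xy'|xy'] := ltnP (b x) (b y); first exact: (not_strongly_connected mono xK yK).
by apply: (not_strongly_connected mono yK xK); rewrite ltn_neqAle eq_sym xy.
Qed.

Lemma Sr_ge_free G : G \subset pairs n -> (2 ^ #|free_pairs G| <= Sr r G)%N.
Proof.
move=> GE; rewrite -card_powerset -(card_in_imset (flipped_inj GE)).
apply: subset_leq_card; apply/fintype.subsetP => _ /imsetP[Z ZF ->].
rewrite powersetE in ZF; rewrite inE flipped_orientation //=.
by apply/forallP => K; apply/implyP; exact: flipped_no_strong_clique.
Qed.

Definition block_cliques G : {set {set 'I_n}} :=
  [set K in block_sets | inner_pairs K \subset G].

(** Each K_r inside a block destroys at most ['C(r, 2)] free pairs. *)
Lemma card_free_pairs G :
  (#|G :&: block_pairs| <= #|free_pairs G| + 'C(r, 2) * #|block_cliques G|)%N.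
Proof.
rewrite /free_pairs; set B := \bigcup_(K in _ | _) _.
rewrite -(cardsID B (G :&: block_pairs)) addnC leq_add2l.
apply: (@leq_trans #|B|); first by rewrite subset_leq_card // finset.subsetIr.
apply: (@leq_trans (\sum_(K in block_sets | inner_pairs K \subset G) #|inner_pairs K|)).
  exact: leq_card_bigcup.
rewrite mulnC -sum_nat_const; rewrite big_mkcond [X in (_ <= X)%N]big_mkcond /=.
apply: leq_sum => K _; case: ifP => // /andP[Kb KG].
have -> : K \in block_cliques G by apply/setIdP.
by move: Kb; rewrite inE card_inner_pairs => /andP[/eqP ->].
Qed.

End LowerBound.

(** An orientation is determined by the set of edges directed from the smaller to the larger
    endpoint. *)
Lemma Sr_le_pairs n r (G : {set {set 'I_n}}) : G \subset pairs n -> (Sr r G <= 2 ^ #|G|)%N.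
Proof.
move=> GE; rewrite /Sr -card_powerset.
pose dec (D : {set 'I_n * 'I_n}) : {set {set 'I_n}} :=
  [set e in G | [exists u : 'I_n, exists v : 'I_n, [&& (u < v)%N, e == [set u; v] & (u, v) \in D]]].
rewrite -(card_in_imset (f := dec)).
  apply: subset_leq_card; apply/fintype.subsetP => _ /imsetP[D _ ->].
  by rewrite powersetE; apply/fintype.subsetP => e; rewrite inE => /andP[].
move=> D1 D2; rewrite !inE => /andP[D1or _] /andP[D2or _] /setP E.
have decE D (u v : 'I_n) : (u < v)%N -> adj G u v -> ([set u; v] \in dec D) = ((u, v) \in D).
  move=> uv adjuv; rewrite inE [_ \in G]adjuv /=.
  apply/existsP/idP => [[x /existsP[y /and3P[xy /eqP e xyD]]]|uvD]; last first.
    by exists u; apply/existsP; exists v; rewrite uv eqxx.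
  have /setP e' := e; have := e' u; have := e' v; rewrite !inE !eqxx orbT /=.
  move=> /esym/orP[/eqP vx|/eqP vy] /esym/orP[/eqP ux|/eqP uy].
  - by rewrite vx ux ltnn in uv.
  - by move: xy uv; rewrite vx uy => /ltnW; rewrite leqNgt => /negPf ->.
  - by rewrite vy ux.
  - by rewrite vy uy ltnn in uv.
have lt_case (u v : 'I_n) : (u < v)%N -> ((u, v) \in D1) = ((u, v) \in D2).
  move=> uv; move: (forallP (forallP D1or u) v) (forallP (forallP D2or u) v).
  case: ifPn => [adjuv _ _|_ /negPf -> /negPf -> //].
  by rewrite -!decE.
apply/setP => -[u v]; have [uv|vu|uv] := ltngtP u v; first exact: lt_case.
  move: (forallP (forallP D1or u) v) (forallP (forallP D2or u) v).
  rewrite (lt_case _ _ vu); case: ifPn => [_|_ /negPf -> /negPf -> //].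
  by case: ((v, u) \in D2); case: ((u, v) \in D1); case: ((u, v) \in D2).
have <- : u = v by apply: val_inj.
move: (forallP (forallP D1or u) u) (forallP (forallP D2or u) u).
by case: ifP => [/(adj_neq GE)|_ /negPf -> /negPf -> //]; rewrite eqxx.
Qed.

(** * Probability estimates *)

Section BlockCounting.
Variables (n r s : nat).
Hypotheses (s2 : (2 <= s)%N) (sn : (s <= n)%N).

Let b (v : 'I_n) := (v %/ s)%N.

(** Only the [n %/ s] full blocks are counted: each has at least [s ^ 2 / 4] pairs, and together
    they cover at least half of the vertices. *)
Lemma block_pairs_ge : (n * s <= 8 * #|block_pairs b|)%N.
Proof.
have s0 : (0 < s)%N by exact: ltnW.
have pt_proof (c : 'I_(n %/ s)) (j : 'I_s) : (c * s + j < n)%N.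
  apply: leq_trans (leq_trunc_div n s); apply: (@leq_trans (c.+1 * s)).
    by rewrite mulSn addnC ltn_add2r.
  by rewrite leq_mul2r ltn_ord orbT.
pose pt c j : 'I_n := Ordinal (pt_proof c j).
have bpt c j : b (pt c j) = c by rewrite /b /= divnMDl // (divn_small (ltn_ord j)) addn0.
have pt_inj c : injective (pt c).
  by move=> i j /(congr1 val) /= /addnI /val_inj.
pose f (a : 'I_(n %/ s) * {set 'I_s}) : {set 'I_n} := pt a.1 @: a.2.
pose D := setX [set: 'I_(n %/ s)] [set J : {set 'I_s} | #|J| == 2%N].
have cardD : #|D| = (n %/ s * 'C(s, 2))%N by rewrite cardsX cardsT card_draws !card_ord.
have f_inj : {in D &, injective f}.
  move=> [c1 J1] [c2 J2]; rewrite !inE /= => /cards2P[i [j [_ J1E]]] _ E.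
  have c12 : c1 = c2.
    have : pt c1 i \in f (c1, J1) by apply: imset_f; rewrite /= J1E !inE eqxx.
    rewrite E => /imsetP[u _ /(congr1 b)]; rewrite !bpt; exact: val_inj.
  by move: E; rewrite /f /= c12 => /(imset_inj (@pt_inj c2)) ->.
have fD : f @: D \subset block_pairs b.
  apply/fintype.subsetP => _ /imsetP[[c J] cJ ->]; move: cJ; rewrite !inE /= => J2.
  rewrite /f /= card_imset // J2 /=; apply/forall_inP => u /imsetP[i _ ->].
  by apply/forall_inP => v /imsetP[j _ ->]; rewrite !bpt.
have := subset_leq_card fD; rewrite card_in_imset // cardD => H.
have : (n < (n %/ s).+1 * s)%N by rewrite mulSn addnC {1}(divn_eq n s) ltn_add2l ltn_pmod.
have : (0 < n %/ s)%N by rewrite divn_gt0.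
have := bin2_mul2 s; move: ('C(s, 2)) (n %/ s)%N (#|block_pairs b|) H => B m M H HB m0 nm.
have H1 : (4 * (m * B) <= 4 * M)%N by rewrite leq_mul2l.
have H2 : (s * s <= 4 * B)%N by move: HB; case: (s) s2 => // s'; rewrite /=; nia.
have : (n <= 2 * (m * s))%N by nia.
nia.
Qed.

Lemma card_block_le (c : nat) : (#|[set v : 'I_n | b v == c]| <= s)%N.
Proof.
have s0 : (0 < s)%N by exact: ltnW.
pose f (v : 'I_n) : 'I_s := Ordinal (ltn_pmod v s0).
have f_inj : {in [set v : 'I_n | b v == c] &, injective f}.
  move=> u v; rewrite !inE /b => /eqP uc /eqP vc /(congr1 val) /= uv.
  by apply: val_inj => /=; rewrite (divn_eq u s) (divn_eq v s) uc vc uv.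
by rewrite -(card_in_imset f_inj) -[leqRHS]card_ord max_card.
Qed.

(** Allowing for an incomplete last block there are at most [(n %/ s).+1] blocks, and [s] times this
    is at most [2 * n] because [s <= n]. *)
Lemma block_sets_le : (0 < r)%N -> (s * #|block_sets r b| <= 2 * n * 'C(s, r))%N.
Proof.
move=> r0; have s0 : (0 < s)%N by exact: ltnW.
pose B c : {set 'I_n} := [set v : 'I_n | b v == c].
have sub : block_sets r b \subset \bigcup_(c < (n %/ s).+1)
    [set K : {set 'I_n} | K \subset B c & #|K| == r].
  apply/fintype.subsetP => K; rewrite inE => /andP[/eqP Kr Kb].
  have /card_gt0P[v vK] : (0 < #|K|)%N by rewrite Kr.
  have lt : (v %/ s < (n %/ s).+1)%N by rewrite ltnS leq_div2r // ltnW.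
  apply/bigcupP; exists (Ordinal lt) => //; rewrite inE Kr eqxx andbT.
  apply/fintype.subsetP => u uK; rewrite inE.
  exact: (forall_inP (forall_inP Kb u uK) v vK).
have H : (#|block_sets r b| <= (n %/ s).+1 * 'C(s, r))%N.
  apply: leq_trans (subset_leq_card sub) _; apply: leq_trans (leq_card_bigcup _ _) _.
  rewrite -[leqRHS](_ : \sum_(c < (n %/ s).+1) 'C(s, r) = _)%N; last first.
    by rewrite sum_nat_const card_ord.
  by apply: leq_sum => c _; rewrite cards_draws leq_bin2l // card_block_le.
have ns : (s * (n %/ s).+1 <= 2 * n)%N.
  by rewrite mulnS mulnC mul2n -addnn leq_add // leq_trunc_div.
apply: (@leq_trans (s * ((n %/ s).+1 * 'C(s, r)))); first by rewrite leq_mul2l H orbT.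
by rewrite mulnA leq_mul2r ns orbT.
Qed.

End BlockCounting.

Lemma block_pairs_cst n : #|block_pairs (fun _ : 'I_n => 0%N)| = 'C(n, 2).
Proof.
rewrite -[in RHS](card_ord n) -card_draws; apply: eq_card => e; rewrite !inE.
suff -> : in_block (fun _ : 'I_n => 0%N) e by rewrite andbT.
by apply/forall_inP => u _; apply/forall_inP.
Qed.

Lemma block_sets_cst n r : (#|block_sets r (fun _ : 'I_n => 0%N)| <= 'C(n, r))%N.
Proof.
rewrite -[in leqRHS](card_ord n) -card_draws; apply: subset_leq_card.
by apply/fintype.subsetP => K; rewrite !inE => /andP[].
Qed.

Section Log2.
Variable R : realType.

Lemma ln2_gt0 : 0 < ln 2 :> R.
Proof. by rewrite ln_gt0 // ltr1n. Qed.

Lemma log2_ge (m N : nat) : (2 ^ m <= N)%N -> m%:R <= log2 N%:R :> R.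
Proof.
move=> mN; rewrite /log2 ler_pdivlMr ?ln2_gt0 // mulr_natl -lnXn //.
rewrite ler_ln ?posrE ?exprn_gt0 ?ltr0n //; last by apply: leq_trans mN; rewrite expn_gt0.
by rewrite -natrX ler_nat.
Qed.

Lemma log2_le (m N : nat) : (N <= 2 ^ m)%N -> log2 N%:R <= m%:R :> R.
Proof.
move=> Nm; rewrite /log2 ler_pdivrMr ?ln2_gt0 // mulr_natl -lnXn //.
(* For [N = 0] the logarithm takes its default value 0. *)
have [->|N0] := posnP N; first by rewrite ln0 // ln_ge0 // exprn_ege1 // ler1n.
by rewrite ler_ln ?posrE ?exprn_gt0 ?ltr0n // -natrX ler_nat.
Qed.

End Log2.

Section ProbabilityBounds.
Variables (R : realType) (n r : nat) (p : R).
Hypotheses (r3 : (3 <= r)%N) (p01 : 0 <= p <= 1).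

Lemma expect_block_cliques (b : 'I_n -> nat) :
  expect (pairs n) p (fun G => #|block_cliques r b G|%:R) = p ^+ 'C(r, 2) * #|block_sets r b|%:R.
Proof.
rewrite (_ : expect _ _ _ = expect (pairs n) p (fun G =>
    \sum_(K in block_sets r b) (inner_pairs K \subset G)%:R)); last first.
  apply: eq_expect => G _; rewrite -sum1_card natr_sum big_mkcond [RHS]big_mkcond /=.
  apply: eq_bigr => K _; 
  rewrite (_ : (K \in block_cliques r b G) = (K \in block_sets r b) && (inner_pairs K \subset G)).
    by case: (K \in block_sets r b) => //=; case: (inner_pairs K \subset G).
  by apply/setIdP/andP.
rewrite expect_sum (eq_bigr (fun=> p ^+ 'C(r, 2))) ?sumr_const ?mulr_natr // => K.
rewrite inE => /andP[/eqP Kr _].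
transitivity (p ^+ #|inner_pairs K|); last by rewrite card_inner_pairs Kr.
by apply: prob_subset; exact: inner_pairs_sub.
Qed.

(** Two bad events each cost [d] times the expected number of edges inside blocks: too few such
    edges (Chebyshev), and too many of them lost to cliques (Markov). *)
Lemma prob_log2_Sr_lower (b : 'I_n -> nat) (d : R) : 0 < d ->
  0 < p * #|block_pairs b|%:R ->
  prob (pairs n) p (fun G =>
    ~~ ((1 - 2 * d) * (p * #|block_pairs b|%:R) <= log2 (Sr r G)%:R)) <=
  (d ^+ 2 * (p * #|block_pairs b|%:R))^-1 +
  'C(r, 2)%:R * #|block_sets r b|%:R * p ^+ 'C(r, 2) / (d * (p * #|block_pairs b|%:R)).
Proof.
set M := p * _ => d0 M0; have dM0 : 0 < d * M by rewrite mulr_gt0.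
have BE : block_pairs b \subset pairs n.
  by apply/fintype.subsetP => e; rewrite inE => /andP[].
pose A1 (G : {set {set 'I_n}}) := d * M <= `|#|G :&: block_pairs b|%:R - M|.
pose A2 (G : {set {set 'I_n}}) := d * M <= 'C(r, 2)%:R * #|block_cliques r b G|%:R.
apply: (@le_trans _ _ (prob (pairs n) p (fun G => A1 G || A2 G))).
  apply: le_prob => // G GE; apply: contraNT; rewrite negb_or /A1 /A2 -!ltNge.
  move=> /andP[]; rewrite ltr_norml => /andP[X _] Y.
  apply: le_trans (log2_ge R (Sr_ge_free b r3 GE)).
  have := card_free_pairs r b G; rewrite -(ler_nat R) natrD natrM; lra.
apply: le_trans (probU (pairs n) p01 A1 A2) _; apply: lerD.
  exact: (chebyshev_card p01 BE d0 M0).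
apply: (le_trans (markov_ineq p01 dM0 _)) => [G _|]; first by rewrite mulr_ge0.
by rewrite expectZ expect_block_cliques [p ^+ _ * _]mulrC mulrA.
Qed.

Lemma prob_log2_Sr_upper (d : R) : 0 < d -> 0 < p * 'C(n, 2)%:R ->
  prob (pairs n) p (fun G => ~~ (log2 (Sr r G)%:R <= (1 + d) * (p * 'C(n, 2)%:R))) <=
  (d ^+ 2 * (p * 'C(n, 2)%:R))^-1.
Proof.
have cardE : #|pairs n| = 'C(n, 2) by rewrite card_draws card_ord.
rewrite -cardE => d0 M0; apply: le_trans (chebyshev_card p01 (subxx _) d0 M0).
apply: le_prob => // G GE; rewrite -ltNge (setIidPl GE) => H.
have := lt_le_trans H (log2_le R (Sr_le_pairs r GE)) => H'.
by have := ler_norm (#|G|%:R - p * #|pairs n|%:R); lra.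
Qed.

End ProbabilityBounds.

Lemma leq_mul_fact_exp k : (k <= k`! * 8 ^ k)%N.
Proof.
apply: (@leq_trans (8 ^ k)); first by rewrite ltnW // ltn_expl.
by rewrite leq_pmull // fact_gt0.
Qed.

Section UpperProbability.
Variables (R : realType) (n r s : nat) (w : R).
Hypotheses (r3 : (3 <= r)%N) (w01 : 0 < w <= 1) (ln_ge1 : 1 <= ln n%:R :> R).

Let k := r.-1.
(** Chosen so that the exponent in [prob_no_clique] becomes [2 * (s * ln n)], twice what a union
    bound over at most [n ^ s] sets consumes. *)
Let L : R := 2 * k`!%:R * 8 ^+ k * ln n%:R.
Hypothesis sL : L <= s%:R * w ^+ k <= 2 * L.

Let p01 : 0 <= w ^+ 2 <= 1.
Proof. by case/andP: w01 => /ltW w0 w1; rewrite exprn_ge0 ?exprn_ile1. Qed.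

Let n_gt0 : (0 < n)%N.
Proof. by case: n ln_ge1 => // H; move: H; rewrite ln0 // ler10. Qed.

Lemma prob_clique_free_set :
  prob (pairs n) (w ^+ 2) (fun G => [exists S : {set 'I_n}, (#|S| == s) &&
    [forall K : {set 'I_n}, (K \subset S) ==> ~~ clique_copy k G K]]) <= n%:R^-1.
Proof.
have k2 : (2 <= k)%N by rewrite /k; case: r r3 => [|[|[|]]].
have [/ltW w0 w1] := andP w01; have [Ls _] := andP sL; have l1 := ln_ge1.
have c1 : 2 * k%:R <= 2 * k`!%:R * 8 ^+ k :> R.
  by rewrite -mulrA ler_pM2l // -natrX -natrM ler_nat leq_mul_fact_exp.
have k2R : 2 <= k%:R :> R by rewrite ler_nat.
have cL : 2 * k`!%:R * 8 ^+ k <= L.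
  by rewrite /L -[leLHS]mulr1 ler_wpM2l //; lra.
have ks : (2 * k <= s)%N.
  rewrite -(ler_nat R) natrM; apply: le_trans c1 _; apply: le_trans cL _.
  by apply: le_trans Ls _; rewrite ler_piMr // exprn_ile1.
have L1 : 1 <= L by lra.
apply: le_trans (prob_exists (pairs n) p01 _ _) _.
have kf : 0 < k`!%:R :> R by rewrite ltr0n fact_gt0.
have expE : s%:R * L / (k`!%:R * 8 ^+ k) = 2 * (s%:R * ln n%:R).
  by rewrite /L; field; rewrite expf_neq0 ?gt_eqF.
apply: (@le_trans _ _ (\sum_(S : {set 'I_n} | #|S| == s) expR (- (2 * (s%:R * ln n%:R))))).
  apply: ler_sum => S /eqP Ss; rewrite -expE -{1}Ss.
  by apply: prob_no_clique; rewrite // Ss.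
rewrite sumr_const -cardsE card_draws card_ord -[leLHS]mulr_natl.
have nE : n%:R = expR (ln n%:R) :> R by rewrite lnK // posrE ltr0n.
apply: (@le_trans _ _ (expR (s%:R * ln n%:R) * expR (- (2 * (s%:R * ln n%:R))))).
  apply: ler_wpM2r; first exact: expR_ge0.
  by rewrite mulrC expRM_natr -nE -natrX ler_nat leq_bin_exp.
rewrite -expRD {3}nE -expRN ler_expR.
have s1 : 1 <= s%:R :> R by rewrite ler1n (leq_trans _ ks) // muln_gt0 (ltnW k2).
have : ln n%:R <= s%:R * ln n%:R :> R by rewrite ler_peMl //; lra.
lra.
Qed.

Lemma prob_log2_Sr_clique_free :
  prob (pairs n) (w ^+ 2) (fun G => ~~ (log2 (Sr r G)%:R <= (n * s)%:R * log2 n.+1%:R :> R)) <= n%:R^-1.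
Proof.
apply: le_trans prob_clique_free_set; apply: le_prob => // G GE.
apply: contraNT; rewrite negb_exists => /forallP noS.
have clique_in (S : {set 'I_n}) : #|S| = s ->
    exists2 K : {set 'I_n}, K \subset S & clique_copy r.-1 G K.
  move=> Ss; have := noS S; rewrite Ss eqxx negb_forall => /existsP[K].
  by rewrite negb_imply negbK => /andP[KS cK]; exists K.
have [->|Sr0] := posnP (Sr r G).
  rewrite {1}/log2 ln0 // mul0r mulr_ge0 // divr_ge0 ?ln_ge0 ?ler1n //.
rewrite /log2 mulrA ler_pM2r ?invr_gt0 ?ln2_gt0 // mulr_natl -lnXn ?ltr0n //.
rewrite ler_ln ?posrE ?exprn_gt0 ?ltr0n // -natrX ler_nat mulnC expnM.
exact: Sr_upper_bound r3 GE clique_in.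
Qed.

End UpperProbability.

(** * Passage to the limit, and growth of the logarithm *)

Section Asymptotics.
Variable R : realType.

Lemma gnp_probE n (p : R) (A : pred {set {set 'I_n}}) :
  gnp_prob p A = prob (pairs n) p A.
Proof.
rewrite /gnp_prob big_mkcondr; apply: eq_bigr => G _.
by case: (A G); rewrite ?mulr1 ?mulr0.
Qed.

Lemma whp_of_compl (p : nat -> R) (A : forall n, pred {set {set 'I_n}}) (eps : nat -> R) :
  (forall n, 0 <= p n <= 1) ->
  (\forall n \near \oo%classic, prob (pairs n) (p n) (fun G => ~~ A n G) <= eps n) ->
  (eps n @[n --> \oo] --> (0 : R))%classic -> whp p A.
Proof.
move=> p01 near_eps eps0; apply: (squeeze_cvgr (f := fun n => 1 - eps n) (h := fun=> 1)).
- near=> n; rewrite gnp_probE prob_le1 // andbT probC lerD2l lerN2.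
  by near: n.
- by rewrite -[X in (_ --> X)%classic]subr0; apply: cvgB => //; exact: cvg_cst.
- exact: cvg_cst.
Unshelve. all: by end_near.
Qed.

Lemma ln_cvgy : (ln n%:R @[n --> \oo] --> (+oo : set_system R))%classic.
Proof.
apply/cvgryPge => A; near=> n.
have nA : expR A <= n%:R :> R.
  near: n; exact: nbhs_infty_ger.
rewrite -(expRK A) ler_ln ?posrE ?expR_gt0 //.
exact: lt_le_trans (expR_gt0 A) nA.
Unshelve. all: by end_near.
Qed.

Lemma inv_ln_cvg0 : ((ln n%:R)^-1 @[n --> \oo] --> (0 : R))%classic.
Proof.
apply/cvgrVy; last first.
  rewrite (_ : unstable.inv_fun _ = fun n => ln n%:R); first exact: ln_cvgy.
  by apply/funext => n /=; rewrite invrK.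
near=> n; rewrite invr_gt0; apply: (@lt_le_trans _ _ 1) => //.
by near: n; move/cvgryPge: ln_cvgy; apply.
Unshelve. all: by end_near.
Qed.

(** Truncate the exponential series at the square. This turns the Chebyshev error of the dense lower
    bound into a multiple of [1 / ln n]. *)
Lemma sqr_ln_le n : (0 < n)%N -> 1 <= ln n%:R :> R -> ln n%:R ^+ 2 <= 2 * n%:R :> R.
Proof.
move=> n0 l1; have /(expR_ge1Dxn 1) : 0 <= ln n%:R :> R by lra.
rewrite lnK ?posrE ?ltr0n // (_ : 2`! = 2)%N //; lra.
Qed.

End Asymptotics.

(** * Explicit error bounds for fixed [n] *)

Section FixedSize.
Variables (R : realType) (n r : nat) (w : R).
Hypotheses (r3 : (3 <= r)%N) (w01 : 0 < w <= 1).

Let p01 : 0 <= w ^+ 2 <= 1.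
Proof. by case/andP: w01 => /ltW w0 w1; rewrite exprn_ge0 ?exprn_ile1. Qed.

Let r1E : r.+1 = (r.-1 + 2)%N. Proof. by case: r r3 => // r' _; rewrite addn2. Qed.

Let r2 : (1 <= r - 2)%N. Proof. by rewrite subn_gt0. Qed.

(** Hence the probability of a given K_r is that of an edge times [(w ^+ r.+1) ^+ (r - 2)], the
    source of the exponent in the threshold. *)
Lemma bin2_exponent : (2 * 'C(r, 2) = 2 + r.+1 * (r - 2))%N.
Proof. by rewrite mulnC bin2_mul2; case: r r3 => [|[|r']] // _; rewrite !subSS subn0 /=; nia. Qed.

Lemma prob_log2_Sr_lower_dense : 1 <= ln n%:R :> R -> 1 <= n%:R * w ^+ r.+1 ->
  prob (pairs n) (w ^+ 2) (fun G =>
    ~~ (n%:R / w ^+ r.-1 / (32 * ln n%:R) <= log2 (Sr r G)%:R)) <=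
  (512 + 64 * 'C(r, 2)%:R) / ln n%:R.
Proof.
move=> l1 nw; have [w0 w1] := andP w01.
have n3 : (2 <= n)%N.
  case: n l1 {nw} => [|[|//]]; first by rewrite ln0 // ler10.
  by rewrite ln1 ler10.
have n0 : 0 < n%:R :> R by rewrite ltr0n; lia.
set l := ln n%:R in l1 *; have l0 : 0 < l by lra.
set v := w ^+ r.+1 in nw *; have v0 : 0 < v by rewrite exprn_gt0.
pose y := (v * l)^-1; have y0 : 0 < y by rewrite invr_gt0 mulr_gt0.
have yE : y * (v * l) = 1 by rewrite mulVf // gt_eqF // mulr_gt0.
(* The maximum keeps pairs inside blocks even when [y < 2]; a block of two vertices contains no
   K_r. *)
pose s := maxn 2 (Num.truncn y).
have s2 : (2 <= s)%N by rewrite leq_maxl.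
have trunc_y : (Num.truncn y)%:R <= y by rewrite truncn_le ltW.
have yn : y <= n%:R.
  have nvl : 1 <= n%:R * (v * l) by rewrite mulrA; nra.
  by rewrite /y -[leLHS]mul1r ler_pdivrMr ?mulr_gt0.
have sn : (s <= n)%N.
  by rewrite geq_max n3 -(ler_nat R) (le_trans trunc_y).
have ys : y <= 2 * s%:R.
  have := truncnS_gt y; have : (Num.truncn y)%:R <= s%:R :> R by rewrite ler_nat leq_maxr.
  have : 1 <= s%:R :> R by rewrite ler1n ltnW.
  by rewrite -natr1; lra.
pose b (v : 'I_n) := (v %/ s)%N.
have := block_pairs_ge s2 sn; rewrite -(ler_nat R) !natrM -/b.
have := block_sets_le s2 sn (ltnW (ltnW r3)); rewrite -(ler_nat R) !natrM -/b.
set M : R := #|block_pairs b|%:R; set N : R := #|block_sets r b|%:R => HN HM.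
have s0 : 0 < s%:R :> R by rewrite ltr0n ltnW.
have w20 : 0 < w ^+ 2 by rewrite exprn_gt0.
have gE : n%:R / w ^+ r.-1 = n%:R * (w ^+ 2 * l * y).
  by rewrite /y /v r1E exprD; field; rewrite !gt_eqF ?exprn_gt0.
have gM : n%:R / w ^+ r.-1 <= 16 * l * (w ^+ 2 * M).
  rewrite gE; have : n%:R * y <= 16 * M by nra.
  move=> /(ler_wpM2l (ltW (mulr_gt0 w20 l0))); nra.
have gn : n%:R <= n%:R / w ^+ r.-1.
  by rewrite ler_pdivlMr ?exprn_gt0 // ler_piMr // exprn_ile1 // ltW.
have M0 : 0 < w ^+ 2 * M by nra.
(* Cliques are rarer than edges inside blocks by a factor of order [ln n]. If [s < r] there are
   none; otherwise [s] is the truncation of [y], so that [(s * v) ^+ (r - 2) <= s * v <= 1 / l]. *)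
have Nl : N * v ^+ (r - 2) * l <= 16 * M.
  have [sr|rs] := ltnP s r.
    have -> : N = 0.
      apply/le_anti/andP; split=> //; move: HN; rewrite bin_small // mulr0.
      by rewrite pmulr_rle0.
    by rewrite !mul0r mulr_ge0.
  have sE : s = Num.truncn y.
    by have := leq_trans r3 rs; rewrite leq_max /= => /ltnW /maxn_idPr.
  have svl : s%:R * v * l <= 1.
    rewrite -mulrA; apply: (@le_trans _ _ (y * (v * l))); last by rewrite yE.
    by apply: ler_wpM2r; [rewrite mulr_ge0 ?ltW | rewrite sE].
  have sv0 : 0 < s%:R * v by rewrite mulr_gt0.
  have sv1 : s%:R * v <= 1 by nra.
  have HN' : s%:R * N <= 2 * n%:R * s%:R ^+ r.
    by apply: le_trans HN _; rewrite -natrX ler_wpM2l ?mulr_ge0 // ler_nat leq_bin_exp.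
  rewrite -(ler_pM2l s0); apply: (@le_trans _ _ (s%:R * (2 * n%:R * s%:R))); last first.
    by rewrite ler_pM2l //; lra.
  apply: (@le_trans _ _ (2 * n%:R * s%:R ^+ r * (v ^+ (r - 2) * l))).
    rewrite [leLHS](_ : _ = s%:R * N * (v ^+ (r - 2) * l)); last by ring.
    by apply: ler_wpM2r => //; rewrite mulr_ge0 ?exprn_ge0 ?ltW.
  have -> : 2 * n%:R * s%:R ^+ r * (v ^+ (r - 2) * l) =
      (2 * n%:R * s%:R ^+ 2) * ((s%:R * v) ^+ (r - 2) * l).
    by rewrite -{1}(subnKC (ltnW r3)) exprD exprMn; ring.
  rewrite [leRHS](_ : _ = 2 * n%:R * s%:R ^+ 2 * 1); last by ring.
  apply: ler_wpM2l; first by rewrite !mulr_ge0 ?exprn_ge0 ?ltW.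
  apply: le_trans svl; apply: ler_wpM2r; first by rewrite ltW.
  by rewrite -[leRHS]expr1; exact: (ler_wiXn2l (ltW sv0) sv1 r2).
(* With [d = 1/4] half of the expected number of edges inside blocks remains, which turns the 16 of
   [gM] into 32. *)
have d0 : 0 < 4^-1 :> R by [].
apply: le_trans (le_trans _ (prob_log2_Sr_lower r3 p01 d0 M0)) _.
  apply: le_prob => // G _; apply: contraNN; apply: le_trans.
  rewrite ler_pdivrMr ?mulr_gt0 //; apply: le_trans gM _.
  by rewrite -/M le_eqVlt; apply/orP; left; apply/eqP; field.
have l2n := sqr_ln_le (ltnW n3) l1; rewrite -/l in l2n.
rewrite mulrDl; apply: lerD.
  rewrite -/M; set T := w ^+ 2 * M in M0 gM *.
  have -> : (4^-1 ^+ 2 * T)^-1 = 16 / T by field; rewrite gt_eqF.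
  rewrite ler_pdivrMr // mulrAC ler_pdivlMr // -(ler_pM2l l0).
  have : n%:R <= 16 * l * T by apply: le_trans gn gM.
  by rewrite expr2 in l2n; lra.
have dM0 : 0 < 4^-1 * (w ^+ 2 * M) by rewrite mulr_gt0.
rewrite -/N -/M ler_pdivrMr // [leRHS]mulrAC ler_pdivlMr //.
rewrite -exprM bin2_exponent exprD exprM -/v.
rewrite [leRHS](_ : _ = 'C(r, 2)%:R * w ^+ 2 * (16 * M)); last by field.
rewrite [leLHS](_ : _ = 'C(r, 2)%:R * w ^+ 2 * (N * v ^+ (r - 2) * l)); last by ring.
by apply: ler_wpM2l => //; rewrite mulr_ge0 // ltW.
Qed.

(** One factor [ln n] comes from the size [s] of the generating sets, the other from the cost
    [log2 n.+1] of naming a vertex. *)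
Lemma prob_log2_Sr_upper_dense : 1 <= ln n%:R :> R ->
  prob (pairs n) (w ^+ 2) (fun G => ~~ (log2 (Sr r G)%:R <=
     8 * (r.-1)`!%:R * 8 ^+ r.-1 / ln 2 * ln n%:R ^+ 2 * (n%:R / w ^+ r.-1))) <=
  (ln n%:R)^-1.
Proof.
move=> l1; have [w0 w1] := andP w01.
have n2 : (2 <= n)%N.
  case: n l1 => [|[|//]]; first by rewrite ln0 // ler10.
  by rewrite ln1 ler10.
set k := r.-1; set c : R := 2 * k`!%:R * 8 ^+ k; pose L := c * ln n%:R.
have c1 : 1 <= c.
  rewrite /c -mulrA -natrX -!natrM ler1n !muln_gt0 /= fact_gt0 expn_gt0 //.
have wk0 : 0 < w ^+ k by rewrite exprn_gt0.
pose s := (Num.truncn (L / w ^+ k)).+1.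
have L1 : 1 <= L by rewrite -[leLHS]mulr1 /L ler_pM.
have Lw0 : 0 <= L / w ^+ k by rewrite divr_ge0 ?ltW //; lra.
have Ls : L <= s%:R * w ^+ k.
  by rewrite -ler_pdivrMr // ltW // truncnS_gt.
(* Rounding up adds at most [w ^+ k <= 1 <= L]. *)
have s2L : s%:R * w ^+ k <= 2 * L.
  have : (Num.truncn (L / w ^+ k))%:R <= L / w ^+ k by rewrite truncn_le.
  rewrite ler_pdivlMr // /s -natr1 mulrDl mul1r.
  have : w ^+ k <= 1 by rewrite exprn_ile1 // ltW.
  lra.
have sL : L <= s%:R * w ^+ k <= 2 * L by rewrite Ls s2L.
apply: le_trans (le_trans _ (prob_log2_Sr_clique_free r3 w01 l1 sL)) _; last first.
  rewrite lef_pV2 ?posrE ?ltr0n ?(ltnW n2) //; last by lra.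
  have n0 : 0 < n%:R :> R by rewrite ltr0n ltnW.
  have n1 : - 1 < n%:R - 1 :> R by lra.
  by have := le_ln1Dx n1; rewrite (_ : 1 + (n%:R - 1) = n%:R :> R); [lra | ring].
apply: le_prob => // G _; apply: contraNN => /le_trans; apply.
have l2 : 0 < ln 2 :> R by exact: ln2_gt0.
have lnS : ln n.+1%:R <= 2 * ln n%:R :> R.
  rewrite mulr_natl -lnXn ?ltr0n ?(ltnW n2) //.
  rewrite ler_ln ?posrE ?exprn_gt0 ?ltr0n ?(ltnW n2) // -natrX ler_nat.
  rewrite -mulnn; apply: (@leq_trans (n * 2)); last by rewrite leq_mul2l n2 orbT.
  by rewrite muln2 -addnn -addn1 leq_add2l ltnW.
rewrite /log2 natrM -mulrA.
have sw : s%:R <= 2 * L / w ^+ k by rewrite ler_pdivlMr.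
rewrite [leRHS](_ : _ = n%:R * ((2 * L / w ^+ k) * (2 * ln n%:R / ln 2))); last first.
  by rewrite /L /c; field; rewrite !gt_eqF.
apply: ler_wpM2l => //; apply: ler_pM => //; first by rewrite divr_ge0 ?ln_ge0 ?ler1n ?ltW.
by rewrite ler_pM2r ?invr_gt0.
Qed.

(** A single block suffices: relative to edges, the expected number of K_r is of order
    [(n * w ^+ r.+1) ^+ (r - 2)], at most [n * w ^+ r.+1] because [r - 2 >= 1]. *)
Lemma prob_log2_Sr_sparse (d : R) : (2 <= n)%N -> 0 < d -> n%:R * w ^+ r.+1 <= 1 ->
  prob (pairs n) (w ^+ 2) (fun G =>
    ~~ ((1 - 2 * d) * (w ^+ 2 * 'C(n, 2)%:R) <= log2 (Sr r G)%:R <=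
        (1 + 2 * d) * (w ^+ 2 * 'C(n, 2)%:R))) <=
  8 * (n%:R ^+ 2 * w ^+ 2)^-1 / d ^+ 2 + 4 * 'C(r, 2)%:R * (n%:R * w ^+ r.+1) / d.
Proof.
move=> n2 d0 nw; have [w0 w1] := andP w01.
have n0 : 0 < n%:R :> R by rewrite ltr0n ltnW.
have w20 : 0 < w ^+ 2 by rewrite exprn_gt0.
have C4 : n%:R ^+ 2 <= 4 * 'C(n, 2)%:R :> R.
  rewrite -natrX -natrM ler_nat; have := bin2_mul2 n.
  by case: n n2 => // n' n2 /=; rewrite expnS expn1; nia.
set M : R := 'C(n, 2)%:R in C4 *.
have n20 : 0 < n%:R ^+ 2 :> R by rewrite exprn_gt0.
have Mpos : 0 < M by lra.
have M0 : 0 < w ^+ 2 * M by rewrite mulr_gt0.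
have Minv : (w ^+ 2 * M)^-1 <= 4 * (n%:R ^+ 2 * w ^+ 2)^-1.
  rewrite -[leLHS]mul1r ler_pdivrMr // mulrAC ler_pdivlMr ?mulr_gt0 //; nra.
pose A1 (G : {set {set 'I_n}}) := ~~ ((1 - 2 * d) * (w ^+ 2 * M) <= log2 (Sr r G)%:R).
pose A2 (G : {set {set 'I_n}}) := ~~ (log2 (Sr r G)%:R <= (1 + 2 * d) * (w ^+ 2 * M)).
apply: (@le_trans _ _ (prob (pairs n) (w ^+ 2) (fun G => A1 G || A2 G))).
  by apply: le_prob => // G _; rewrite negb_and.
apply: le_trans (probU (pairs n) p01 A1 A2) _.
have cst := block_pairs_cst n.
have /(_ d d0) := prob_log2_Sr_lower (b := fun _ : 'I_n => 0%N) r3 p01.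
rewrite cst -/M => /(_ M0) H1.
have d20 : 0 < 2 * d by lra.
have H2 := prob_log2_Sr_upper r p01 d20 M0.
apply: le_trans (lerD H1 H2) _.
have : (d ^+ 2 * (w ^+ 2 * M))^-1 <= 4 * (n%:R ^+ 2 * w ^+ 2)^-1 / d ^+ 2.
  by rewrite invfM mulrC ler_pM2r // invr_gt0 exprn_gt0.
have : ((2 * d) ^+ 2 * (w ^+ 2 * M))^-1 <= 4 * (n%:R ^+ 2 * w ^+ 2)^-1 / d ^+ 2.
  rewrite invfM mulrC; apply: ler_pM => //.
  - by rewrite invr_ge0 ltW.
  - by rewrite invr_ge0 exprn_ge0 // ltW.
  - by rewrite lef_pV2 ?posrE ?exprn_gt0 //; apply: lerXn2r; rewrite ?nnegrE; lra.
suff : 'C(r, 2)%:R * #|block_sets r (fun _ : 'I_n => 0%N)|%:R * (w ^+ 2) ^+ 'C(r, 2) /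
    (d * (w ^+ 2 * M)) <= 4 * 'C(r, 2)%:R * (n%:R * w ^+ r.+1) / d by lra.
set v := w ^+ r.+1 in nw *; have v0 : 0 < v by rewrite exprn_gt0.
set N := #|_|; have NE : N%:R <= n%:R ^+ r :> R.
  rewrite -natrX ler_nat; exact: leq_trans (block_sets_cst n r) (leq_bin_exp n r).
rewrite -exprM bin2_exponent exprD exprM -/v.
rewrite ler_pdivrMr ?mulr_gt0 //.
rewrite [leRHS](_ : _ = 'C(r, 2)%:R * w ^+ 2 * (n%:R * v * (4 * M))); last by field; rewrite gt_eqF.
rewrite [leLHS](_ : _ = 'C(r, 2)%:R * w ^+ 2 * (N%:R * v ^+ (r - 2))); last by ring.
apply: ler_wpM2l; first by rewrite mulr_ge0 // ltW.
apply: (@le_trans _ _ (n%:R ^+ r * v ^+ (r - 2))).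
  by rewrite ler_wpM2r // exprn_ge0 // ltW.
rewrite -{1}(subnKC (ltnW r3)) exprD -mulrA -exprMn mulrC.
have nv0 : 0 <= n%:R * v by rewrite mulr_ge0 ?ltW.
apply: ler_pM => //.
- exact: exprn_ge0.
- by rewrite -[leRHS]expr1; exact: (ler_wiXn2l nv0 nw r2).
Qed.

End FixedSize.

(** * From real exponents to natural powers of roots *)

Section PowerConversions.
Variable R : realType.

(** Rewrites the power of [p] in (ii) in terms of [w]. *)
Lemma powR_half (x : R) m : 0 <= x -> x `^ (m%:R / 2) = Num.sqrt x ^+ m.
Proof. by move=> x0; rewrite mulrC powRrM powR12_sqrt // powR_mulrn // sqrtr_ge0. Qed.

(** With [u] the root of [n] of order [r.+1], comparing [p] with the threshold means comparing
    [u * w] with 1, and [n * w ^+ r.+1] is a power of [u * w]. *)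
Lemma powR_threshold n r : exists2 u : R, 0 <= u &
  u ^+ r.+1 = n%:R /\ n%:R `^ (- (2 / (r%:R + 1))) = (u ^+ 2)^-1.
Proof.
exists (n%:R `^ (r.+1%:R^-1)); first exact: powR_ge0.
rewrite -!powR_mulrn ?powR_ge0 // -!powRrM mulVf ?pnatr_eq0 // powRr1 //; split=> //.
by rewrite powRN natr1 [2 / _]mulrC.
Qed.

End PowerConversions.

Theorem theorem1p8 (R : realType) (r : nat) (p : nat -> R)
    (hr : (3 <= r)%N) (hp : forall n : nat, 0 <= p n <= 1) :
  (much_less (fun n => n%:R `^ (- 2)) p ->
   much_less p (fun n => n%:R `^ (- (2 / (r%:R + 1)))) ->
   whp_asymp p (fun n G => log2 (Sr r G)%:R) (fun n => p n * 'C(n, 2)%:R))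
  /\
  (much_less (fun n => n%:R `^ (- (2 / (r%:R + 1)))) p ->
   whp_tildeTheta p (fun n G => log2 (Sr r G)%:R)
     (fun n => n%:R / p n `^ ((r%:R - 1) / 2))).
Proof.
have sqrt01 n : p n != 0 -> 0 < Num.sqrt (p n) <= 1.
  move=> pn0; have /andP[p0 p1] := hp n; rewrite sqrtr_gt0 lt_def pn0 p0 /=.
  by rewrite -sqrtr1 ler_sqrt // ltr01.
have sqrtK n : Num.sqrt (p n) ^+ 2 = p n by rewrite sqr_sqrtr //; case/andP: (hp n).
have rE : r%:R - 1 = (r.-1)%:R :> R by case: r hr => // r' _; rewrite -natr1 addrK.
split=> [[pnz lim1] [_ lim2]|[pnz lim]].
- pose x n : R := n%:R `^ (- 2) / p n; pose z n := p n / n%:R `^ (- (2 / (r%:R + 1))).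
  pose t n := 8 * x n + 4 * 'C(r, 2)%:R * z n.
  have t0 : (t n @[n --> \oo] --> (0 : R))%classic.
    rewrite -[0](_ : 8 * 0 + 4 * 'C(r, 2)%:R * 0 = 0); last by rewrite !mulr0 addr0.
    by apply: cvgD; apply: cvgMr.
  (* The fourth root of the error [t], so that both [t / d ^+ 2 = d ^+ 2] and [t / d = d ^+ 3]
     vanish in the limit. *)
  pose d n := Num.sqrt (Num.sqrt (t n)).
  have d0 : (d n @[n --> \oo] --> (0 : R))%classic.
    apply/cvgr0Pnorm_le => e e0; near=> n.
    have te : t n <= (e ^+ 2) ^+ 2.
      apply: le_trans (ler_norm _) _; near: n; apply: (cvgr0_norm_le _ t0).
      by rewrite !exprn_gt0.
    have e2 : 0 <= e ^+ 2 by rewrite exprn_ge0 // ltW.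
    have <- : Num.sqrt (Num.sqrt ((e ^+ 2) ^+ 2)) = e.
      by rewrite sqrtr_sqr ger0_norm // sqrtr_sqr gtr0_norm.
    by rewrite ger0_norm ?sqrtr_ge0 // !ler_wsqrtr.
  exists (fun n => 2 * d n); split.
    by rewrite -[0](mulr0 2); apply: cvgMr.
  apply: (@whp_of_compl _ _ _ (fun n => d n ^+ 2 + d n ^+ 3)) => //.
    near=> n.
    have pn : p n != 0 by near: n.
    have n2 : (2 <= n)%N by near: n; exact: nbhs_infty_ge.
    have z1 : z n <= 1.
      by apply: le_trans (ler_norm _) _; near: n; exact: (cvgr0_norm_le _ lim2).
    have /andP[w0 w1] := sqrt01 _ pn; have p0 : 0 < p n by rewrite -sqrtK exprn_gt0.
    have n0 : 0 < n%:R :> R by rewrite ltr0n ltnW.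
    have [u u0 [un uE]] := powR_threshold R n r.
    have zE : z n = (u * Num.sqrt (p n)) ^+ 2.
      by rewrite /z uE invrK exprMn sqrtK mulrC.
    have xE : x n = (n%:R ^+ 2 * p n)^-1.
      by rewrite /x powRN powR_mulrn // -invfM.
    have uw1 : u * Num.sqrt (p n) <= 1.
      by move: z1; rewrite zE expr_le1 // mulr_ge0 // ltW.
    have nwE : n%:R * Num.sqrt (p n) ^+ r.+1 = (u * Num.sqrt (p n)) ^+ r.+1.
      by rewrite exprMn un.
    (* The left side is the power [r.+1 >= 2] of [u * w <= 1], and [z n] is its square. *)
    have nwz : n%:R * Num.sqrt (p n) ^+ r.+1 <= z n.
      by rewrite nwE zE; apply: ler_wiXn2l => //; [rewrite mulr_ge0 // ltW | exact: (ltnW (leqW hr))].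
    have x0 : 0 < x n by rewrite xE invr_gt0 mulr_gt0 ?exprn_gt0.
    have z0 : 0 <= z n by rewrite zE exprn_ge0 // mulr_ge0 // ltW.
    have Cz0 : 0 <= 4 * 'C(r, 2)%:R * z n by apply: mulr_ge0 z0; rewrite mulr_ge0.
    have tn0 : 0 < t n.
      by rewrite /t ltr_pwDl // mulr_gt0.
    have dn0 : 0 < d n by rewrite !sqrtr_gt0.
    have d4 : d n ^+ 4 = t n.
      by rewrite -[4%N]/(2 * 2)%N exprM !sqr_sqrtr ?sqrtr_ge0 // ltW.
    rewrite -{1}(sqrtK n).
    have := @prob_log2_Sr_sparse R n r (Num.sqrt (p n)) hr (sqrt01 _ pn) (d n) n2 dn0 (le_trans nwz z1).
    rewrite sqrtK => /le_trans; apply.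
    have -> : d n ^+ 2 + d n ^+ 3 = t n / d n ^+ 2 + t n / d n.
      by rewrite -d4; field; rewrite gt_eqF.
    rewrite -xE; apply: lerD.
      by rewrite ler_pM2r ?invr_gt0 ?exprn_gt0 // /t lerDl.
    rewrite ler_pM2r ?invr_gt0 // /t; apply: (@le_trans _ _ (4 * 'C(r, 2)%:R * z n)).
      by rewrite ler_wpM2l // mulr_ge0.
    by rewrite lerDr mulr_ge0 // ltW.
  rewrite (_ : (fun n => _) = fun n => d n * d n + d n * (d n * d n)); last first.
    by apply/funext => n; ring.
  rewrite -[0](_ : 0 * 0 + 0 * (0 * 0) = 0); last by rewrite !mul0r addr0.
  by apply: cvgD; [apply: cvgM | apply: cvgM => //; apply: cvgM].
(* One constant for both directions; the exponent 2 of the logarithm is dictated by the upper bound,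
   the lower bound losing only one factor [ln n]. *)
pose C : R := 32 + 8 * (r.-1)`!%:R * 8 ^+ r.-1 / ln 2.
have c20 : 0 <= 8 * (r.-1)`!%:R * 8 ^+ r.-1 / ln 2 :> R.
  by rewrite divr_ge0 ?mulr_ge0 // ltW // ln2_gt0.
have C0 : 0 < C by rewrite /C; lra.
exists C, 2%N; split => //.
(* The failure probabilities add up: 512 and the binomial term from the lower bound, 1 from the
   upper bound. *)
apply: (@whp_of_compl _ _ _ (fun n => (513 + 64 * 'C(r, 2)%:R) / ln n%:R)) => //.
  near=> n.
  have pn : p n != 0 by near: n.
  have l1 : 1 <= ln n%:R :> R by near: n; move/cvgryPge: (@ln_cvgy R); apply.
  have z1 : n%:R `^ (- (2 / (r%:R + 1))) / p n <= 1.
    by apply: le_trans (ler_norm _) _; near: n; exact: (cvgr0_norm_le _ lim).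
  have w01 := sqrt01 _ pn; have /andP[w0 w1] := w01.
  have p0 : 0 < p n by rewrite -sqrtK exprn_gt0.
  have [u u0 [un uE]] := powR_threshold R n r.
  have n0 : 0 < n%:R :> R.
    by rewrite ltr0n lt0n; apply: contraTneq l1 => ->; rewrite ln0 // ler10.
  have u_gt0 : 0 < u by rewrite lt_def u0 andbT; apply: contraTneq n0 => u00; rewrite -un u00 expr0n ltxx.
  have uw : 1 <= u * Num.sqrt (p n).
    move: z1; rewrite uE -invfM invf_le1 ?mulr_gt0 ?exprn_gt0 // -{1}sqrtK -exprMn.
    by rewrite expr_ge1 // mulr_ge0 // ltW.
  have nw : 1 <= n%:R * Num.sqrt (p n) ^+ r.+1 by rewrite -un -exprMn exprn_ege1.
  rewrite rE powR_half ?(ltW p0) //.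
  set g := n%:R / _.
  have g0 : 0 <= g by rewrite divr_ge0 // exprn_ge0 // ltW.
  have l0 : 0 < ln n%:R :> R by apply: lt_le_trans l1.
  have lC : 32 * ln n%:R <= C * ln n%:R ^+ 2.
    rewrite expr2 mulrA; apply: (@le_trans _ _ (C * ln n%:R)).
      by rewrite ler_pM2r // /C lerDl.
    by rewrite ler_peMr // mulr_ge0 ?ltW.
  pose A1 (G : {set {set 'I_n}}) := ~~ (g / (32 * ln n%:R) <= log2 (Sr r G)%:R).
  pose A2 (G : {set {set 'I_n}}) := ~~ (log2 (Sr r G)%:R <=
     8 * (r.-1)`!%:R * 8 ^+ r.-1 / ln 2 * ln n%:R ^+ 2 * g).
  apply: (@le_trans _ _ (prob (pairs n) (p n) (fun G => A1 G || A2 G))).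
    apply: le_prob => // G _; rewrite /A1 /A2 -negb_and; apply: contraNN => /andP[lo hi].
    apply/andP; split.
      apply: le_trans lo; apply: ler_wpM2l => //.
      by rewrite lef_pV2 // posrE ?mulr_gt0 // (lt_le_trans _ lC) // mulr_gt0.
    apply: le_trans hi _; rewrite ler_wpM2r // ler_wpM2r ?exprn_ge0 //; first by rewrite ltW.
    by rewrite /C lerDr.
  apply: le_trans (probU (pairs n) (hp n) A1 A2) _.
  have H1 := prob_log2_Sr_lower_dense hr w01 l1 nw.
  have H2 := prob_log2_Sr_upper_dense hr w01 l1.
  rewrite sqrtK in H1 H2; apply: le_trans (lerD H1 H2) _.
  by rewrite -[X in _ + X]mul1r -mulrDl ler_wpM2r ?invr_ge0 ?(ltW l0) //; lra.
rewrite -[0](mulr0 (513 + 64 * 'C(r, 2)%:R)); apply: cvgMr; exact: inv_ln_cvg0.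
Unshelve. all: by end_near.
Qed.
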